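(* Let $X\in\mathbb R^{n\times p}$ be fixed and $Y=X\beta^0+\epsilon$ with $\epsilon$ a vector of i.i.d. standard Gaussians. Let, for some $t>0$, $$\lambda>\|v_{-S_0}\|_\infty\sqrt{2(\log(2p)+t)},\qquad\bar v_j:=v_j\sqrt{2(\log(2p)+t)}/\lambda,\ j\notin S_0 .$$ (i) For all $x>0$, with probability at least $1-\exp[-t]-\exp[-x]$, $$\|X(\hat\beta-\beta^0)\|_2\le\sqrt{\frac{s_0}{\hat\kappa^2(1-\bar v,S_0)}}\sqrt{\frac{\lambda^2}{n}}+\sqrt{s_0}+\sqrt{2x}.$$ (ii) Suppose moreover that $\hat\kappa(1+\bar v,S_0)>0$ and that the following betamin condition holds: $$|\beta_j^0|>\lambda\big(\mathbf b_j(\bar v)+\bar u_j\big),\qquad \mathrm{sign}(\beta_j^0)=z_j^*(\bar v)\qquad\text{for all } j\in S_0 .$$ Then for all $x>0$ the upper bound in (i) and the following lower bound hold simultaneously, still with probability at least $1-\exp[-t]-\exp[-x]$: there is a solution $\hat\beta$ of the KKT conditions of the Lasso such that $$\|X(\hat\beta-\beta^0)\|_2\ge\sqrt{\frac{s_0}{\hat\kappa^2(1+\bar v,S_0)}}\sqrt{\frac{\lambda^2}{n}}-\sqrt{s_0}-\sqrt{2x}.$$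
   Context: $\beta^0\in\mathbb R^p$, $S_0:=\{j:\beta_j^0\ne0\}$, $s_0:=|S_0|$. The Lasso is $\hat\beta\in\arg\min_{b\in\mathbb R^p}\{\|Y-Xb\|_2^2+2\lambda\|b\|_1\}$; its KKT conditions are $X^TX(\hat\beta-\beta^0)+\lambda\hat\zeta=X^T\epsilon$ with $\hat\zeta\in\partial\|\hat\beta\|_1$, where $\partial\|b\|_1=\{z:\ z^Tb=\|b\|_1,\ \|z\|_\infty\le1\}$. For $S\subset\{1,\dots,p\}$, $b_S$ has entries $b_j1\{j\in S\}$ (or denotes the vector $(b_j)_{j\in S}$), $b_{-S}:=b_{S^c}$, and $X_S$ is the matrix of columns of $X$ in $S$. Standing assumption: $X_{S_0}^TX_{S_0}$ is invertible. For $j\notin S_0$, $v_j:=\|X_j-X_j\mathrm PX_{S_0}\|_2$, where $X_j\mathrm PX_{S_0}$ is the orthogonal projection of the $j$-th column $X_j$ on the column span of $X_{S_0}$; $v_{-S_0}=(v_j)_{j\notin S_0}$. For $j\in S_0$, $u_j^2$ is the $j$-th diagonal element of $(X_{S_0}^TX_{S_0})^{-1}$ ($u_j\ge0$) and $\bar u_j:=u_j\sqrt{2(\log(2p)+t)}/\lambda$. For a non-negative weight vector $w$ indexed by $S_0^c$ and $W=\mathrm{diag}(w)$, $$\hat\kappa^2(w,S_0):=\min\{s_0\|Xb\|_2^2/n:\ \|b_{S_0}\|_1-\|Wb_{-S_0}\|_1=1\},$$ and $1\pm\bar v$ is the vector with entries $1\pm\bar v_j$. The upper bound is read as $+\infty$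 if $\hat\kappa(1-\bar v,S_0)=0$. With $\bar W:=\mathrm{diag}(1+\bar v)$, let $$b^*(\bar v)\in\arg\min\{\|Xb\|_2^2:\ \|b_{S_0}\|_1-\|\bar Wb_{-S_0}\|_1=1\},\qquad z_j^*(\bar v):=\mathrm{sign}(b_j^*(\bar v)),\ j\in S_0 .$$ Let $\mathcal W(\bar v):=\{w\in\mathbb R^{p-s_0}:\ 1-\bar v_j\le w_j\le1+\bar v_j\ \forall j\}$; for $w\in\mathcal W(\bar v)$ and $W=\mathrm{diag}(w)$ let $$b(w)\in\arg\min\{\|Xb\|_2^2:\ z_{S_0}^{*T}(\bar v)\,b_{S_0}-\|Wb_{-S_0}\|_1\ge1\},$$ and $$\mathbf b_j(\bar v):=\max_{w\in\mathcal W(\bar v)}|b_j(w)|/\|Xb(w)\|_2^2,\qquad j\in S_0 .$$ *)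

(* Defs.v *)
From mathcomp Require Import all_boot all_order all_algebra.
From mathcomp Require Import all_classical all_reals all_analysis.

Set Implicit Arguments.
Unset Strict Implicit.
Unset Printing Implicit Defensive.

Import Order.TTheory GRing.Theory Num.Theory.
Import numFieldNormedType.Exports.

Local Open Scope classical_set_scope.
Local Open Scope ring_scope.

Definition argmin (T : Type) (R : realType) (D : set T) (f : T -> R) : set T :=
  [set x | D x /\ forall y, D y -> f x <= f y].

Definition l2norm (R : realType) n (y : 'cV[R]_n) : R :=
  Num.sqrt (\sum_i y i 0 ^+ 2).

Definition l1norm (R : realType) p (b : 'cV[R]_p) : R := \sum_j `|b j 0|.

(* [b_S], kept in R^p by zero-padding. *)
Definition restr (R : realType) p (S : {set 'I_p}) (b : 'cV[R]_p) : 'cV[R]_p :=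
  \col_j (if j \in S then b j 0 else 0).

Definition supp (R : realType) p (b : 'cV[R]_p) : {set 'I_p} :=
  [set j | b j 0 != 0]%SET.

Definition lasso (R : realType) n p (X : 'M[R]_(n, p)) (Y : 'cV[R]_n) (lam : R)
    : set 'cV[R]_p :=
  argmin setT (fun b => l2norm (Y - X *m b) ^+ 2 + 2 * lam * l1norm b).

(* [mx_norm] is the sup norm of the entries. *)
Definition subdiff_l1 (R : realType) p (b : 'cV[R]_p) : set 'cV[R]_p :=
  [set z | (z^T *m b) 0 0 = l1norm b /\ mx_norm z <= 1].

Definition lasso_kkt (R : realType) n p (X : 'M[R]_(n, p)) (beta0 : 'cV[R]_p)
    (e : 'cV[R]_n) (lam : R) : set 'cV[R]_p :=
  [set b | exists2 z, subdiff_l1 b z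
           & X^T *m X *m (b - beta0) + lam *: z = X^T *m e].

(* [X_S]; the columns are indexed by 'I_#|S| through [enum_val]. *)
Definition cols (R : realType) n p (X : 'M[R]_(n, p)) (S : {set 'I_p})
    : 'M[R]_(n, #|S|) :=
  colsub (fun k : 'I_#|S| => enum_val k) X.

Definition gram (R : realType) n p (X : 'M[R]_(n, p)) (S : {set 'I_p})
    : 'M[R]_#|S| :=
  (cols X S)^T *m cols X S.

(* Orthogonal projection of [y] on the column span of [A].  Subspaces are encoded
   as row spaces: the span is that of [A^T], and [kermx A], the row space of
   the [u] with [u *m A = 0], is its orthogonal complement. *)
Definition orth_proj (R : realType) n k (A : 'M[R]_(n, k)) (y : 'cV[R]_n)
    : 'cV[R]_n :=
  (y^T *m proj_mx <<A^T>>%MS (kermx A))^T.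

Lemma orth_projP (R : realType) n k (A : 'M[R]_(n, k)) (y : 'cV[R]_n) :
  ((orth_proj A y)^T <= A^T)%MS /\ A^T *m (y - orth_proj A y) = 0.
Proof.
have dx : (<<A^T>> :&: kermx A = 0)%MS.
  apply/eqP; rewrite -submx0; apply/rV_subP => u.
  rewrite sub_capmx genmxE => /andP[/submxP[x ->] /sub_kermxP xAA].
  rewrite submx0; have /eqP : (x *m A^T) *m (x *m A^T)^T = 0.
    by rewrite trmx_mul trmxK mulmxA xAA mul0mx.
  move/eqP/matrixP/(_ 0 0); rewrite !mxE => /psumr_eq0P z0.
  apply/eqP/rowP => i; rewrite [RHS]mxE; apply/eqP; rewrite -sqrf_eq0 expr2.
  have /(_ i isT) : forall j, true -> (x *m A^T) 0 j * (x *m A^T)^T j 0 = 0.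
    by apply: z0 => j _; rewrite [X in _ * X]mxE -expr2 sqr_ge0.
  by rewrite [X in _ * X]mxE => ->.
split; first by rewrite trmxK (submx_trans (proj_mx_sub _ _ _)) ?genmxE.
have full : (y^T <= <<A^T>> + kermx A)%MS.
  apply: submx_full; rewrite /row_full (mxdirectP (introT mxdirect_addsP dx)) /= genmxE.
  by rewrite mxrank_ker mxrank_tr subnKC ?rank_leq_row.
have /sub_kermxP := proj_mx_compl_sub full.
by move/(congr1 trmx); rewrite trmx_mul trmx0 linearB/= trmxK.
Qed.

Definition vj (R : realType) n p (X : 'M[R]_(n, p)) (S : {set 'I_p})
    (j : 'I_p) : R :=
  l2norm (col j X - orth_proj (cols X S) (col j X)).

Definition v_off (R : realType) n p (X : 'M[R]_(n, p)) (S : {set 'I_p})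
    : 'cV[R]_p :=
  restr (~: S)%SET (\col_j vj X S j).

Definition uj (R : realType) n p (X : 'M[R]_(n, p)) (S : {set 'I_p})
    (j : 'I_p) (jS : j \in S) : R :=
  Num.sqrt (invmx (gram X S) (enum_rank_in jS j) (enum_rank_in jS j)).

Definition noise_level (R : realType) (p : nat) (t : R) : R :=
  Num.sqrt (2 * (ln (2 * p%:R) + t)).

(* A weight vector indexed by the complement of [S] is zero-padded to R^p. *)
Definition vbar (R : realType) n p (X : 'M[R]_(n, p)) (S : {set 'I_p})
    (lam t : R) : 'cV[R]_p :=
  \col_j (v_off X S j 0 * noise_level p t / lam).

Definition ubar (R : realType) n p (X : 'M[R]_(n, p)) (S : {set 'I_p})
    (lam t : R) (j : 'I_p) (jS : j \in S) : R :=
  uj X jS * noise_level p t / lam.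

Definition plus1 (R : realType) p (S : {set 'I_p}) (v : 'cV[R]_p) : 'cV[R]_p :=
  restr (~: S)%SET (const_mx 1 + v).

Definition minus1 (R : realType) p (S : {set 'I_p}) (v : 'cV[R]_p) : 'cV[R]_p :=
  restr (~: S)%SET (const_mx 1 - v).

(* ||W b_{-S}||_1 with W = diag(w) *)
Definition wl1_off (R : realType) p (S : {set 'I_p}) (w b : 'cV[R]_p) : R :=
  l1norm (diag_mx w^T *m restr (~: S)%SET b).

Definition slice (R : realType) p (S : {set 'I_p}) (w : 'cV[R]_p)
    : set 'cV[R]_p :=
  [set b | l1norm (restr S b) - wl1_off S w b = 1].

(* The minimum defining kappa^2 is attained as soon as the slice is nonempty,
   i.e. S is nonempty; for S empty this is the minimum of the empty set, +oo. *)
Definition kappa2 (R : realType) n p (X : 'M[R]_(n, p)) (w : 'cV[R]_p)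
    (S : {set 'I_p}) : \bar R :=
  ereal_inf [set (#|S|%:R * l2norm (X *m b) ^+ 2 / n%:R)%:E | b in slice S w].

Definition kappa (R : realType) n p (X : 'M[R]_(n, p)) (w : 'cV[R]_p)
    (S : {set 'I_p}) : \bar R :=
  sqrte (kappa2 X w S).

(* sqrt(s / kappa^2) sqrt(lam^2 / n); in \bar R the inverse of 0 is +oo. *)
Definition main_term (R : realType) n p (X : 'M[R]_(n, p)) (w : 'cV[R]_p)
    (S : {set 'I_p}) (lam : R) : \bar R :=
  (sqrte (#|S|%:R%:E / kappa2 X w S) * (Num.sqrt (lam ^+ 2 / n%:R))%:E)%E.

Definition bstar_set (R : realType) n p (X : 'M[R]_(n, p)) (S : {set 'I_p})
    (v : 'cV[R]_p) : set 'cV[R]_p :=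
  argmin (slice S (plus1 S v)) (fun b => l2norm (X *m b) ^+ 2).

Definition sign_on (R : realType) p (S : {set 'I_p}) (b : 'cV[R]_p)
    : 'cV[R]_p :=
  restr S (map_mx Num.sg b).

Definition weights (R : realType) p (S : {set 'I_p}) (v : 'cV[R]_p)
    : set 'cV[R]_p :=
  [set w | forall j, if j \in S then w j 0 = 0
                     else 1 - v j 0 <= w j 0 <= 1 + v j 0].

Definition bw_set (R : realType) n p (X : 'M[R]_(n, p)) (S : {set 'I_p})
    (z w : 'cV[R]_p) : set 'cV[R]_p :=
  argmin [set b | 1 <= (z^T *m restr S b) 0 0 - wl1_off S w b]
         (fun b => l2norm (X *m b) ^+ 2).

(* For a selection [b] of minimizers; [ereal_sup] is the maximum whenever that
   exists.  If X b(w) = 0 for some w, the bound is +oo at every j in S with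
   b_j(w) != 0. *)
Definition bold_b (R : realType) n p (X : 'M[R]_(n, p)) (S : {set 'I_p})
    (v : 'cV[R]_p) (b : 'cV[R]_p -> 'cV[R]_p) (j : 'I_p) : \bar R :=
  ereal_sup [set (`|b w j 0|%:E / (l2norm (X *m b w) ^+ 2)%:E)%E
            | w in weights S v].

Definition mutually_independent d (T : measurableType d) (R : realType)
    (P : probability T R) (n : nat) (e : 'I_n -> {RV P >-> R}) : Prop :=
  forall (J : {set 'I_n}) (A : 'I_n -> set R),
    (forall i, i \in J -> measurable (A i)) ->
    P (\bigcap_(i in [set` J]) (e i @^-1` A i)) =
    (\prod_(i in J) P (e i @^-1` A i))%E.

Definition iid_std_gaussian d (T : measurableType d) (R : realType)
    (P : probability T R) (n : nat) (e : 'I_n -> {RV P >-> R}) : Prop :=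
  mutually_independent e /\
  forall i (A : set R), measurable A ->
    distribution P (e i) A = normal_prob 0 1 A.

Definition noise d (T : measurableType d) (R : realType)
    (P : probability T R) (n : nat) (e : 'I_n -> {RV P >-> R}) (o : T)
    : 'cV[R]_n :=
  \col_i e i o.

(* [E] need not be measurable: it contains an event of probability >= q. *)
Definition prob_ge d (T : measurableType d) (R : realType)
    (P : probability T R) (E : set T) (q : R) : Prop :=
  exists A, [/\ measurable A, A `<=` E & (q%:E <= P A)%E].

(* Main.v *)
Require Import Defs.
From mathcomp Require Import all_boot all_order all_algebra.
From mathcomp Require Import all_classical all_reals all_analysis.
From mathcomp Require Import measurable_realfun.
From mathcomp Require Import ring lra.
Set Implicit Arguments.
Unset Strict Implicit.
Unset Printing Implicit Defensive.
Import Order.TTheory GRing.Theory Num.Theory.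
Import numFieldNormedType.Exports.
Local Open Scope classical_set_scope.
Local Open Scope ring_scope.

(** Let [S] be the support of [beta0], [U] the least squares coefficients of the
    noise on the columns in [S], and [V_j] the inner product of the noise with the
    residual of the column [j] outside [S]; then X^T eps = X^T X U + V.
    Chernoff's bound, for linear forms of the noise and for the quadratic form
    |XU|^2, controls [U], [V] and |XU| simultaneously, and on that event both
    bounds are deterministic.

    Upper bound: the minimality of the Lasso along the segment from [bhat] to
    [beta0] gives |Xd|^2 <= |XU| |Xd| + lam (|d_S|_1 - |(1 - v) d_{-S}|_1) for
    d = bhat - beta0.

    Lower bound: every solution [bhat] of the KKT conditions works.  Read weights
    [w] off its subgradient zeta and put D = bhat - beta0 - U and
    a = lam b(w) / |X b(w)|^2.  Adding the optimality conditions of [bhat] and of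
    b(w) gives |X(D + a)|^2 <= lam sum_{j in S} (z_j - zeta_j) (D_j + a_j), where
    the betamin condition makes every summand nonpositive.  Hence
    |XD| = |Xa| = lam / |X b(w)| >= lam / |X b*|. *)

(** * Euclidean geometry of column vectors *)

Section dot.
Context {R : realType}.

Definition dot n (u v : 'cV[R]_n) : R := (u^T *m v) 0 0.

Lemma dot_sum n (u v : 'cV[R]_n) : dot u v = \sum_i u i 0 * v i 0.
Proof. by rewrite /dot mxE; apply: eq_bigr => i _; rewrite mxE. Qed.

End dot.

Section dot_theory.
Context {R : realType} {n : nat}.
Implicit Types u v w : 'cV[R]_n.

Lemma dotC u v : dot u v = dot v u.
Proof. by rewrite !dot_sum; apply: eq_bigr => i _; rewrite mulrC. Qed.

Lemma dotDr u v w : dot u (v + w) = dot u v + dot u w.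
Proof. by rewrite /dot mulmxDr mxE. Qed.

Lemma dotDl u v w : dot (v + w) u = dot v u + dot w u.
Proof. by rewrite dotC dotDr !(dotC u). Qed.

Lemma dotZr a u v : dot u (a *: v) = a * dot u v.
Proof. by rewrite /dot -scalemxAr mxE. Qed.

Lemma dotZl a u v : dot (a *: u) v = a * dot u v.
Proof. by rewrite dotC dotZr dotC. Qed.

Lemma dotNr u v : dot u (- v) = - dot u v.
Proof. by rewrite -scaleN1r dotZr mulN1r. Qed.

Lemma dotNl u v : dot (- u) v = - dot u v.
Proof. by rewrite dotC dotNr dotC. Qed.

Lemma dotBr u v w : dot u (v - w) = dot u v - dot u w.
Proof. by rewrite dotDr dotNr. Qed.

Lemma dotBl u v w : dot (v - w) u = dot v u - dot w u.
Proof. by rewrite dotDl dotNl. Qed.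

Lemma dot_mulmx m (A : 'M[R]_(n, m)) u (v : 'cV_m) :
  dot u (A *m v) = dot (A^T *m u) v.
Proof. by rewrite /dot trmx_mul trmxK mulmxA. Qed.

Lemma dot0l u : dot 0 u = 0.
Proof. by rewrite -(scale0r 0) dotZl mul0r. Qed.

Lemma dot0r u : dot u 0 = 0.
Proof. by rewrite dotC dot0l. Qed.

Lemma dot_ge0 u : 0 <= dot u u.
Proof. by rewrite dot_sum sumr_ge0// => i _; rewrite -expr2 sqr_ge0. Qed.

Lemma dot_eq0 u : (dot u u == 0) = (u == 0).
Proof.
apply/eqP/eqP => [|->]; last by rewrite dot0r.
rewrite dot_sum => /psumr_eq0P => u0; apply/colP => i; rewrite mxE.
have /u0/(_ i isT)/eqP : forall j, true -> 0 <= u j 0 * u j 0.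
  by move=> j _; rewrite -expr2 sqr_ge0.
by rewrite mulf_eq0 orbb => /eqP.
Qed.

Lemma l2normE u : l2norm u = Num.sqrt (dot u u).
Proof. by rewrite /l2norm dot_sum. Qed.

Lemma sqr_l2norm u : l2norm u ^+ 2 = dot u u.
Proof. by rewrite l2normE sqr_sqrtr// dot_ge0. Qed.

Lemma l2norm_ge0 u : 0 <= l2norm u.
Proof. exact: sqrtr_ge0. Qed.

Lemma l2norm_eq0 u : (l2norm u == 0) = (u == 0).
Proof. by rewrite -dot_eq0 -sqr_l2norm sqrf_eq0. Qed.

Lemma l2normZ a u : l2norm (a *: u) = `|a| * l2norm u.
Proof.
by rewrite l2normE dotZr dotZl mulrA -expr2 sqrtrM ?sqr_ge0// sqrtr_sqr -l2normE.
Qed.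

Lemma l2normN u : l2norm (- u) = l2norm u.
Proof. by rewrite -scaleN1r l2normZ normrN1 mul1r. Qed.

(** Cauchy-Schwarz: the squared norm of |v|u - |u|v is 2|u||v|(|u||v| - u.v). *)
Lemma dot_le_l2norm u v : dot u v <= l2norm u * l2norm v.
Proof.
have [u0|u0] := eqVneq u 0.
  rewrite u0 dot0l mulr_ge0 ?l2norm_ge0//.
have [v0|v0] := eqVneq v 0.
  rewrite v0 dot0r mulr_ge0 ?l2norm_ge0//.
have pu : 0 < l2norm u by rewrite lt_def l2norm_ge0 l2norm_eq0 u0.
have pv : 0 < l2norm v by rewrite lt_def l2norm_ge0 l2norm_eq0 v0.
have := dot_ge0 (l2norm v *: u - l2norm u *: v).
rewrite !(dotBr, dotBl, dotZr, dotZl) -!sqr_l2norm (dotC v u) => h.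
rewrite -subr_ge0 -(pmulr_rge0 _ (mulr_gt0 pu pv)).
nra.
Qed.

Lemma l2norm_le_dot u c : 0 <= c -> dot u u <= c ^+ 2 -> l2norm u <= c.
Proof. by move=> c0; rewrite -sqr_l2norm ler_sqr ?nnegrE ?l2norm_ge0. Qed.

Lemma l2normD u v : l2norm (u + v) <= l2norm u + l2norm v.
Proof.
apply: l2norm_le_dot; first by rewrite addr_ge0 ?l2norm_ge0.
rewrite !(dotDr, dotDl) -!sqr_l2norm (dotC v u).
have := dot_le_l2norm u v; nra.
Qed.

End dot_theory.

(** * Expectations of products of independent variables *)

Lemma measurable_set_bool d (T : measurableType d) (f : T -> bool) :
  measurable_fun setT f -> measurable [set x | f x].
Proof. by move=> /(_ measurableT [set true]); rewrite setTI; exact. Qed.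

Lemma measurable_set_ge0_lt (R : realType) (f : R -> R) (s : R) :
  measurable_fun setT f -> measurable [set y | 0 <= s < f y].
Proof.
move=> mf; apply: (measurable_set_bool (f := fun y => (0 <= s) && (s < f y))).
by apply: measurable_and => //; exact: measurable_fun_ltr.
Qed.

Section layer_cake.
Context d (T : measurableType d) (R : realType).
Variable m : {sigma_finite_measure set T -> \bar R}.
Local Open Scope ereal_scope.

(** [f (Y x)] is the Lebesgue length of the set of s with 0 <= s < f (Y x), and Tonelli exchanges
    the two integrals. *)
Lemma layer_cake (W : T -> \bar R) (Y : T -> R) (f : R -> R) :
  measurable_fun setT W -> (forall x, 0 <= W x) -> measurable_fun setT Y ->
  measurable_fun setT f -> (forall y, 0 <= f y)%R ->
  \int[m]_x (W x * (f (Y x))%:E) =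
  \int[lebesgue_measure]_s \int[m]_x (W x * (\1_[set y | (0 <= s < f y)%R] (Y x))%:E).
Proof.
move=> mW W0 mY mf f0.
pose I (p : T * measurableTypeR R) : R :=
  \1_[set q : T * measurableTypeR R | (0 <= q.2 < f (Y q.1))%R] p.
have mI : measurable_fun setT I.
  apply: measurable_indic.
  apply: (measurable_set_bool (f := fun p : T * measurableTypeR R =>
    (0 <= p.2)%R && (p.2 < f (Y p.1))%R)).
  apply: measurable_and; first exact: measurable_fun_ler.
  apply: measurable_fun_ltr => //; apply: (measurableT_comp mf).
  exact: (measurableT_comp mY).
transitivity (\int[m]_x \int[lebesgue_measure]_s (W x * (I (x, s))%:E)).
  apply: eq_integral => x _.
  rewrite ge0_integralZl//; last 2 first.
    by apply/measurable_EFinP/(measurableT_comp mI).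
    by move=> s _; rewrite lee_fin.
  congr (_ * _).
  have -> : (fun s => (I (x, s))%:E) = (fun s => (\1_`[0%R, f (Y x)[ s)%:E).
    apply/funext => s; congr _%:E; rewrite /I !indicE; congr (_%:R).
  rewrite integral_indic//= setIT lebesgue_measure_itv/= lte_fin.
  by case: ltgtP (f0 (Y x)) => // [_ _|<- _]; rewrite ?EFinN ?sube0.
rewrite (fubini_tonelli (fun p : T * measurableTypeR R => W p.1 * (I p)%:E))//=.
- apply: emeasurable_funM; first exact: (measurableT_comp mW).
  exact/measurable_EFinP.
- by move=> p; rewrite mule_ge0// lee_fin.
Qed.

End layer_cake.

(** The hypothesis on sets says that the weighted measures W1 m1 and W2 m2 have the same image under
    [Y1] and [Y2]; the layer cake formula extends this to functions through the superlevel sets of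
    [f]. It serves both to factor independent products and to bring in the normal density. *)
Lemma eq_integral_comp d1 d2 (T1 : measurableType d1) (T2 : measurableType d2)
    (R : realType) (m1 : {sigma_finite_measure set T1 -> \bar R})
    (m2 : {sigma_finite_measure set T2 -> \bar R})
    (W1 : T1 -> \bar R) (Y1 : T1 -> R) (W2 : T2 -> \bar R) (Y2 : T2 -> R) :
  measurable_fun setT W1 -> (forall x, 0 <= W1 x)%E -> measurable_fun setT Y1 ->
  measurable_fun setT W2 -> (forall x, 0 <= W2 x)%E -> measurable_fun setT Y2 ->
  (forall A, measurable A -> \int[m1]_x (W1 x * (\1_A (Y1 x))%:E) =
                             \int[m2]_x (W2 x * (\1_A (Y2 x))%:E))%E ->
  forall f : R -> R, measurable_fun setT f -> (forall y, 0 <= f y) ->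
  (\int[m1]_x (W1 x * (f (Y1 x))%:E) = \int[m2]_x (W2 x * (f (Y2 x))%:E))%E.
Proof.
move=> mW1 W10 mY1 mW2 W20 mY2 E f mf f0; rewrite !layer_cake//.
apply: eq_integral => s _; apply: E; exact: measurable_set_ge0_lt.
Qed.

Section independence.
Context d (T : measurableType d) (R : realType) (P : probability T R) (n : nat).
Variable e : 'I_n -> {RV P >-> R}.

Lemma integral_prod_indic (A : 'I_n -> set R) :
  mutually_independent e -> (forall i, measurable (A i)) ->
  (\int[P]_o (\prod_i \1_(A i) (e i o))%:E =
   \prod_i \int[P]_o (\1_(A i) (e i o))%:E)%E.
Proof.
move=> ind mA.
have mB i : measurable (e i @^-1` A i).
  by rewrite -[X in measurable X]setTI; exact: measurable_funPT.
under eq_bigr => i _.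
  rewrite (_ : (fun o => _) = (fun o => (\1_(e i @^-1` A i) o)%:E)); last first.
    by apply/funext.
  rewrite integral_indic// setIT; over.
rewrite (eq_bigl (mem [set: 'I_n]%SET)); last by move=> i; rewrite /= finset.in_setT.
rewrite -ind//.
rewrite -[X in P X]setIT -integral_indic//; last first.
  by apply: fin_bigcap_measurable => // i _.
apply: eq_integral => o _; congr _%:E.
rewrite indicE; case: (boolP (o \in _)); rewrite ?inE/= => Ho.
  rewrite big1// => i _; rewrite indicE mem_set//; apply: (Ho i).
  by rewrite /= finset.in_setT.
have [i Hi] : exists i, ~ A i (e i o).
  by apply/existsNP => H; move: Ho; rewrite notin_setE; apply => i _; exact: H.
by rewrite (bigD1 i)//= indicE memNset// mul0r.
Qed.

Lemma integral_prod_indep (f : 'I_n -> R -> R) :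
  mutually_independent e -> (forall i, measurable_fun setT (f i)) ->
  (forall i y, 0 <= f i y) ->
  (\int[P]_o (\prod_i f i (e i o))%:E =
   \prod_i \int[P]_o (f i (e i o))%:E)%E.
Proof.
move=> ind mf f0.
(* Induction on the number of factors not yet known to be indicators, collected in [D]; for [D]
   empty the claim is independence itself. *)
suff H (D : {set 'I_n}) (g : 'I_n -> R -> R) :
    (forall i, measurable_fun setT (g i)) -> (forall i y, 0 <= g i y) ->
    (forall i, i \notin D -> exists A, measurable A /\ g i = \1_A) ->
    (\int[P]_o (\prod_i g i (e i o))%:E =
     \prod_i \int[P]_o (g i (e i o))%:E)%E.
  by apply: (H [set: 'I_n]%SET f) => // i; rewrite inE.
have [m] := ubnP #|D|; elim: m D g => // m IH D g /ltnSE Dm mg g0 gA.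
have [D0|[k kD]] := set_0Vmem D.
  have /choice[A AP] : forall i, exists A, measurable A /\ g i = \1_A.
    by move=> i; apply: gA; rewrite D0 inE.
  have -> : g = fun i => \1_(A i) by apply/funext => i; exact: (AP i).2.
  apply: integral_prod_indic => // i; exact: (AP i).1.
pose W1 o := (\prod_(i < n | i != k) g i (e i o))%:E.
pose W2 := (\prod_(i < n | i != k) \int[P]_o (g i (e i o))%:E)%E.
have W20 : (0 <= W2)%E.
  by apply: prode_ge0 => i _; apply: integral_ge0 => o _; rewrite lee_fin.
have mgY i : measurable_fun setT (fun o => g i (e i o)).
  exact: (measurableT_comp (mg i)).
rewrite [RHS](bigD1 k)//= -/W2.
transitivity (\int[P]_o (W1 o * (g k (e k o))%:E))%E.
  by apply: eq_integral => o _; rewrite (bigD1 k)//= mulrC EFinM.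
transitivity (\int[P]_o (W2 * (g k (e k o))%:E))%E; last first.
  rewrite ge0_integralZl//; first by rewrite muleC.
    exact/measurable_EFinP.
  by move=> o _; rewrite lee_fin.
(* With the other factors as a weight, the factor [k] need only be tested on indicators, which
   removes [k] from [D]. *)
apply: (eq_integral_comp (W1 := W1) (W2 := fun=> W2)) => //.
- apply/measurable_EFinP; rewrite (_ : (fun _ => _) = fun o =>
      \prod_(i < n) (if i != k then g i (e i o) else 1)).
    by apply: measurable_prod => i _; case: (i != k).
  by apply/funext => o; rewrite big_mkcond.
- by move=> o; rewrite lee_fin prodr_ge0.
move=> A mA.
pose h i := if i == k then \1_A else g i.
have mh i : measurable_fun setT (h i).
  by rewrite /h; case: ifP => // _; exact: measurable_indic.
have h0 i y : 0 <= h i y by rewrite /h; case: ifP.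
have H : (\int[P]_o (\prod_i h i (e i o))%:E =
          \prod_i \int[P]_o (h i (e i o))%:E)%E.
  apply: (IH (D :\ k)%SET) => //.
    by apply: leq_trans Dm; rewrite [X in (_ < X)%N](cardsD1 k) kD.
  move=> i; rewrite !inE negb_and negbK /h; case: eqP => [_ _|_ /= iD].
    by exists A.
  exact: gA.
transitivity (\int[P]_x (\prod_(i < n) h i (e i x))%:E)%E.
  apply: eq_integral => o _; rewrite (bigD1 k)//= {1}/h eqxx mulrC EFinM.
  by congr ((_%:E * _)%E); apply: eq_bigr => i /negPf ik; rewrite /h ik.
rewrite H ge0_integralZl//; last first.
  apply/measurable_EFinP; apply: (measurableT_comp (measurable_indic mA)).
  exact: measurable_funPT.
rewrite (bigD1 k)//= {1}/h eqxx muleC; congr (_ * _)%E.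
by apply: eq_bigr => i /negPf ik; rewrite /h ik.
Qed.

End independence.

(** * Gaussian concentration *)

Section normal_integrals.
Context {R : realType}.
Implicit Types m s c y th : R.

Lemma measurable_EFin_normal_pdf m s :
  measurable_fun setT (fun y : measurableTypeR R => (normal_pdf m s y)%:E).
Proof. by apply/measurable_EFinP; exact: measurable_normal_pdf. Qed.

(** Completing the square: tilting by exp(c y) moves the mean to c. *)
Lemma normal_pdf_expR_mul c y :
  normal_pdf 0 1 y * expR (c * y) = expR (c ^+ 2 / 2) * normal_pdf c 1 y.
Proof.
rewrite !normal_pdfE ?oner_neq0// /normal_fun -mulrA [RHS]mulrCA -!expRD.
by congr (_ * expR _); field.
Qed.

Lemma integral_normal_expR_mul c :
  (\int[lebesgue_measure]_y ((normal_pdf 0 1 y)%:E * (expR (c * y))%:E) =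
   (expR (c ^+ 2 / 2))%:E)%E.
Proof.
under eq_integral do rewrite -EFinM normal_pdf_expR_mul EFinM.
rewrite ge0_integralZl ?lee_fin ?expR_ge0 ?invr_ge0//; last 2 first.
- exact: measurable_EFin_normal_pdf.
- by move=> y _; rewrite lee_fin normal_pdf_ge0.
by rewrite integral_normal_pdf mule1.
Qed.

(** Tilting by exp(th y^2) leaves a multiple of the centred normal density of variance 1/(1 - 2
    th). *)
Lemma normal_pdf_expR_sqr th y : th < 2^-1 ->
  normal_pdf 0 1 y * expR (th * y ^+ 2) =
  (Num.sqrt (1 - 2 * th))^-1 * normal_pdf 0 (Num.sqrt (1 - 2 * th))^-1 y.
Proof.
move=> th2; have q0 : 0 < 1 - 2 * th by lra.
set q := Num.sqrt _; have q_gt0 : 0 < q by rewrite sqrtr_gt0.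
have qE : q ^+ 2 = 1 - 2 * th by rewrite sqr_sqrtr// ltW.
rewrite !normal_pdfE ?oner_neq0 ?invr_neq0 ?gt_eqF// /normal_fun /normal_peak.
rewrite -mulrA -expRD [RHS]mulrA; congr (_ * expR _).
  rewrite -[(q^-1) ^+ 2 * _ *+ 2]mulrnAr -[1 ^+ 2 * _ *+ 2]mulrnAr.
  rewrite (sqrtrM _ (sqr_ge0 q^-1)) (sqrtrM _ (sqr_ge0 1)) !sqrtr_sqr normr1.
  rewrite mul1r gtr0_norm ?invr_gt0//.
  by rewrite invfM invrK mulKf// gt_eqF.
rewrite expr1n subr0 exprVn qE; field.
by rewrite gt_eqF.
Qed.

Lemma integral_normal_expR_sqr th : th < 2^-1 ->
  (\int[lebesgue_measure]_y ((normal_pdf 0 1 y)%:E * (expR (th * y ^+ 2))%:E) =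
   ((Num.sqrt (1 - 2 * th))^-1)%:E)%E.
Proof.
move=> th2.
under eq_integral do rewrite -EFinM normal_pdf_expR_sqr// EFinM.
rewrite ge0_integralZl ?lee_fin ?expR_ge0 ?invr_ge0//; last 2 first.
- exact: measurable_EFin_normal_pdf.
- by move=> y _; rewrite lee_fin normal_pdf_ge0.
by rewrite integral_normal_pdf mule1.
Qed.

End normal_integrals.

Section gaussian.
Context d (T : measurableType d) (R : realType) (P : probability T R) (n : nat).
Variable e : 'I_n -> {RV P >-> R}.
Hypothesis gauss : iid_std_gaussian e.

Lemma integral_std_gaussian i (f : R -> R) :
  measurable_fun setT f -> (forall y, 0 <= f y) ->
  (\int[P]_o (f (e i o))%:E =
   \int[lebesgue_measure]_y ((normal_pdf 0 1 y)%:E * (f y)%:E))%E.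
Proof.
move=> mf f0; transitivity (\int[P]_o (1 * (f (e i o))%:E))%E.
  by apply: eq_integral => o _; rewrite mul1e.
apply: (eq_integral_comp (m2 := lebesgue_measure) (W1 := fun=> 1%E)
  (W2 := fun y : measurableTypeR R => (normal_pdf 0 1 y)%:E) (Y2 := idfun)) => //.
- exact: measurable_EFin_normal_pdf.
- by move=> y; rewrite lee_fin normal_pdf_ge0.
- exact: measurable_id.
move=> A mA; under eq_integral do rewrite mul1e.
transitivity (P (e i @^-1` A)).
  rewrite (_ : (fun o => _) = (fun o => (\1_(e i @^-1` A) o)%:E)) //.
  rewrite integral_indic ?setIT//.
  by rewrite -[X in measurable X]setTI; exact: measurable_funPT.
transitivity (normal_prob 0 1 A); first exact: gauss.2.
rewrite /normal_prob integral_mkcond; apply: eq_integral => y _.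
by rewrite patchE indicE /=; case: (y \in A); rewrite ?mule1 ?mule0.
Qed.

Lemma measurable_noise_dot (c : 'cV[R]_n) :
  measurable_fun setT (fun o => dot c (noise e o)).
Proof.
under eq_fun do rewrite dot_sum.
apply: measurable_sum => i; under eq_fun do rewrite mxE.
by apply: measurable_funM => //; exact: measurable_funPT.
Qed.

Lemma integral_expR_dot_noise (c : 'cV[R]_n) :
  (\int[P]_o (expR (dot c (noise e o)))%:E = (expR (dot c c / 2))%:E)%E.
Proof.
transitivity (\int[P]_o (\prod_i (fun i y => expR (c i 0 * y)) i (e i o))%:E)%E.
  apply: eq_integral => o _; rewrite dot_sum expR_sum; congr _%:E.
  by apply: eq_bigr => i _; rewrite mxE.
have mf (a : R) : measurable_fun setT (fun y : R => expR (a * y)).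
  by apply: measurableT_comp => //; exact: measurable_funM.
rewrite (integral_prod_indep (f := fun i y => expR (c i 0 * y)) gauss.1)//.
under eq_bigr => i _.
  rewrite (integral_std_gaussian i (f := fun y => expR (c i 0 * y)))//.
  rewrite integral_normal_expR_mul; over.
by rewrite prodEFin dot_sum mulr_suml expR_sum.
Qed.

End gaussian.

(** Here M = M^T M, whose trace is the sum of the squared norms of the columns. *)
Lemma projmx_eq0 (R : realType) n (M : 'M[R]_n) :
  M^T = M -> M *m M = M -> \tr M = 0 -> M = 0.
Proof.
move=> Ms Mi; rewrite -Mi -{1}Ms /mxtrace.
have -> : \sum_i (M^T *m M) i i = \sum_i dot (col i M) (col i M).
  apply: eq_bigr => i _; rewrite mxE dot_sum; apply: eq_bigr => j _.
  by rewrite !mxE.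
move=> /psumr_eq0P => H; rewrite Mi; apply/matrixP => i j.
have /H/(_ j isT)/eqP : forall k, true -> 0 <= dot (col k M) (col k M).
  by move=> k _; exact: dot_ge0.
by rewrite dot_eq0 => /eqP/colP/(_ i); rewrite !mxE.
Qed.

(** Any nonzero column of M, normalized, is fixed because M M = M. *)
Lemma projmx_unit_vector (R : realType) n (M : 'M[R]_n) :
  M *m M = M -> M != 0 -> exists2 a : 'cV[R]_n, dot a a = 1 & M *m a = a.
Proof.
move=> Mi M0; have [j Mj] : exists j, col j M != 0.
  apply/existsP; apply: contraNT M0 => /existsPn H; apply/eqP/matrixP => i j.
  by have := H j; rewrite negbK => /eqP/colP/(_ i); rewrite !mxE.
exists ((l2norm (col j M))^-1 *: col j M).
  by rewrite dotZl dotZr -sqr_l2norm expr2 mulKf ?mulVf ?l2norm_eq0.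
by rewrite -scalemxAr colE mulmxA Mi.
Qed.

(** * Chernoff bounds for linear and quadratic forms of the noise *)

Section gaussian_tails.
Context d (T : measurableType d) (R : realType) (P : probability T R) (n : nat).
Variable e : 'I_n -> {RV P >-> R}.
Hypothesis gauss : iid_std_gaussian e.

Lemma measurable_noise_quad (M : 'M[R]_n) :
  measurable_fun setT (fun o => dot (noise e o) (M *m noise e o)).
Proof.
under eq_fun do rewrite dot_sum.
apply: measurable_sum => i; under eq_fun do rewrite !mxE.
apply: measurable_funM; first exact: measurable_funPT.
apply: measurable_sum => j; under eq_fun do rewrite mxE.
by apply: measurable_funM => //; exact: measurable_funPT.
Qed.

(* Peeling a unit vector [a] off the range of [M], the factor
   exp(th (a.eps)^2) is the integral of exp(sqrt(2 th) y a.eps) against the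
   standard normal density in [y]: exchanging the integrals reduces the
   quadratic form to one of smaller rank, at the cost of a linear term. *)
Lemma integral_expR_quad_noise (th : R) : 0 <= th -> th < 2^-1 ->
  forall (s : nat) (M : 'M[R]_n) (c : 'cV[R]_n),
  M^T = M -> M *m M = M -> \tr M = s%:R -> M *m c = 0 ->
  (\int[P]_o (expR (th * dot (noise e o) (M *m noise e o) +
                    dot c (noise e o)))%:E =
   ((Num.sqrt (1 - 2 * th))^-1 ^+ s * expR (dot c c / 2))%:E)%E.
Proof.
move=> th0 th2; set q := (Num.sqrt _)^-1.
elim=> [|s IH] M c Ms Mi Mtr Mc.
  rewrite (projmx_eq0 Ms Mi Mtr) expr0 mul1r.
  under eq_integral do rewrite mul0mx dot0r mulr0 add0r.
  exact: integral_expR_dot_noise.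
have [a aa Ma] : exists2 a : 'cV[R]_n, dot a a = 1 & M *m a = a.
  apply: projmx_unit_vector => //; apply/eqP => M0; move/eqP: Mtr.
  by rewrite M0 mxtrace0 eq_sym pnatr_eq0.
have aM : a^T *m M = a^T by rewrite -{2}Ma trmx_mul Ms.
have ca : dot c a = 0.
  by rewrite -Ma dot_mulmx Ms Mc dot0l.
have aaT : a^T *m a = 1%:M.
  by apply/matrixP => i j; rewrite !ord1 -[LHS]/(dot a a) aa mxE.
(* [N] projects on the orthogonal complement of [a] in the range of [M]; its trace is one less. *)
pose N := M - a *m a^T.
have Ns : N^T = N by rewrite /N linearB/= trmx_mul trmxK Ms.
have Na : N *m a = 0 by rewrite mulmxBl Ma -mulmxA aaT mulmx1 subrr.
have Ni : N *m N = N.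
  rewrite {2}/N mulmxBr mulmxA Na mul0mx subr0 mulmxBl Mi -mulmxA aM.
  by [].
have Ntr : \tr N = s%:R.
  by rewrite linearB/= Mtr mxtrace_mulC aaT mxtrace1 -natrB// subn1.
have Nc : N *m c = 0.
  rewrite mulmxBl Mc sub0r -mulmxA (_ : a^T *m c = 0) ?mulmx0 ?oppr0//.
  by apply/matrixP => i j; rewrite !ord1 -[LHS]/(dot a c) dotC ca mxE.
have quadM x : dot x (M *m x) = dot x (N *m x) + dot a x ^+ 2.
  rewrite /N mulmxBl dotBr (_ : dot x (a *m a^T *m x) = dot a x ^+ 2) ?subrK//.
  by rewrite -mulmxA dot_mulmx dot_sum big_ord1 expr2.
(* Since r^2 / 2 = th, the normal mean in y of exp(r y (a.eps)) is exp(th (a.eps)^2). *)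
pose r := Num.sqrt (2 * th).
have rE : r ^+ 2 = 2 * th by rewrite sqr_sqrtr// mulr_ge0.
pose F (z : T * measurableTypeR R) : \bar R :=
  ((normal_pdf 0 1 z.2)%:E *
   (expR (th * dot (noise e z.1) (N *m noise e z.1) +
          dot (c + (r * z.2) *: a) (noise e z.1)))%:E)%E.
have mlin b : measurable_fun setT (fun o => dot b (noise e o)).
  exact: measurable_noise_dot.
have mF : measurable_fun setT F.
  apply: emeasurable_funM.
    exact: (measurableT_comp (measurable_EFin_normal_pdf 0 1)).
  apply/measurable_EFinP; apply: measurableT_comp => //.
  under eq_fun do rewrite dotDl dotZl.
  apply: measurable_funD.
    apply: measurable_funM => //.
    exact: (measurableT_comp (measurable_noise_quad N)).
  apply: measurable_funD; first exact: (measurableT_comp (mlin c)).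
  apply: measurable_funM; first exact: measurable_funM.
  exact: (measurableT_comp (mlin a)).
have mpdf (h : measurableTypeR R -> R) : measurable_fun setT h ->
    measurable_fun setT (fun y => (normal_pdf 0 1 y)%:E * (expR (h y))%:E)%E.
  move=> mh; apply: emeasurable_funM; first exact: measurable_EFin_normal_pdf.
  by apply/measurable_EFinP; exact: measurableT_comp.
have F0 z : (0 <= F z)%E by rewrite mule_ge0// lee_fin normal_pdf_ge0.
transitivity (\int[P]_o \int[lebesgue_measure]_y F (o, y))%E.
  apply: eq_integral => o _; rewrite quadM mulrDr addrAC expRD.
  transitivity (\int[lebesgue_measure]_y
      ((expR (th * dot (noise e o) (N *m noise e o) + dot c (noise e o)))%:E *
       ((normal_pdf 0 1 y)%:E * (expR ((r * dot a (noise e o)) * y))%:E)))%E.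
    rewrite ge0_integralZl//; last 2 first.
    - by apply: mpdf; exact: measurable_funM.
    - by move=> y _; rewrite mule_ge0// lee_fin normal_pdf_ge0.
    rewrite integral_normal_expR_mul -EFinM; congr (_ * expR _)%:E.
    by rewrite exprMn rE; field.
  apply: eq_integral => y _; rewrite /F/= muleCA; congr (_ * _)%E.
  rewrite -EFinM -expRD; congr (expR _)%:E.
  by rewrite dotDl dotZl; ring.
rewrite (fubini_tonelli F)//.
transitivity (\int[lebesgue_measure]_y ((q ^+ s * expR (dot c c / 2))%:E *
    ((normal_pdf 0 1 y)%:E * (expR (th * y ^+ 2))%:E)))%E.
  apply: eq_integral => y _; rewrite /F/= ge0_integralZl//; last 2 first.
  - apply/measurable_EFinP; apply: measurableT_comp => //.
    apply: measurable_funD => //.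
    by apply: measurable_funM => //; exact: measurable_noise_quad.
  - by rewrite lee_fin normal_pdf_ge0.
  rewrite (IH N)//; last first.
    by rewrite mulmxDr Nc add0r -scalemxAr Na scaler0.
  rewrite [RHS]muleCA -[in RHS]EFinM; congr (_ * _%:E)%E.
  (* [a] is a unit vector orthogonal to [c], so |c + r y a|^2 / 2 = |c|^2 / 2 + th y^2; integrating
     exp(th y^2) will give one more factor [q]. *)
  rewrite -mulrA -expRD; congr (_ * expR _).
  rewrite !(dotDl, dotDr, dotZl, dotZr) aa (dotC a) ca.
  by rewrite (_ : th = r ^+ 2 / 2); [field|rewrite rE; field].
rewrite ge0_integralZl//; last 3 first.
- by apply: mpdf; apply: measurable_funM => //; exact: measurable_funX.
- by move=> y _; rewrite mule_ge0// lee_fin normal_pdf_ge0.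
- by rewrite lee_fin mulr_ge0// exprn_ge0// invr_ge0.
rewrite integral_normal_expR_sqr// -EFinM -/q exprS; congr _%:E.
by rewrite mulrC mulrA.
Qed.

(** Markov's inequality: the indicator of a <= g is at most exp(g - a). *)
Lemma le_measure_expR (g : T -> R) (a K : R) : measurable_fun setT g ->
  (\int[P]_o (expR (g o))%:E = K%:E)%E ->
  (P [set o | (a <= g o)%R] <= (K * expR (- a))%:E)%E.
Proof.
move=> mg gK.
have mA : measurable [set o | a <= g o].
  by apply: measurable_set_bool; exact: measurable_fun_ler.
have mexp : measurable_fun setT (fun o => (expR (g o))%:E).
  by apply/measurable_EFinP; exact: measurableT_comp.
rewrite -[X in P X]setIT -integral_indic// EFinM -gK -ge0_integralZr//.
apply: ge0_le_integral => //.
- exact/measurable_EFinP/measurable_indic.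
- exact: emeasurable_funM.
move=> o _; rewrite -EFinM -expRD lee_fin indicE.
case: (boolP (o \in _)) => [|_]; last by rewrite expR_ge0.
rewrite inE/= => ag; rewrite (le_trans _ (expR_ge1Dx _))//; lra.
Qed.

(** Chernoff's bound for c and -c, each scaled by tau / |c|, with exponent tau^2 / 2 - tau^2. For c
    = 0 the strict inequality makes the event empty. *)
Lemma gaussian_tail (c : 'cV[R]_n) (tau : R) : 0 <= tau ->
  (P [set o | (l2norm c * tau < `|dot c (noise e o)|)%R] <=
   (2 * expR (- (tau ^+ 2 / 2)))%:E)%E.
Proof.
move=> tau0; have [->|c0] := eqVneq c 0.
  rewrite (_ : [set _ | _] = set0) ?measure0 ?lee_fin ?mulr_ge0//.
  apply/seteqP; split=> o //=.
  by rewrite dot0l l2normE dot0l sqrtr0 mul0r normr0 ltxx.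
have pc : 0 < l2norm c by rewrite lt_def l2norm_ge0 l2norm_eq0 c0.
have one_sided (b : 'cV[R]_n) : dot b b = l2norm c ^+ 2 ->
    (P [set o | (tau ^+ 2 <= dot (tau / l2norm c *: b) (noise e o))%R] <=
     (expR (- (tau ^+ 2 / 2)))%:E)%E.
  move=> bc; apply: (le_trans (le_measure_expR _ _ (integral_expR_dot_noise gauss _))).
    exact: measurable_noise_dot.
  rewrite lee_fin -expRD dotZl dotZr bc ler_expR.
  by rewrite mulrA -expr2 exprMn exprVn mulfVK ?sqrf_eq0 ?gt_eqF//; lra.
have mle (f : T -> R) : measurable_fun setT f -> measurable [set o | tau ^+ 2 <= f o].
  by move=> mf; apply: measurable_set_bool; exact: measurable_fun_ler.
pose B b := [set o | tau ^+ 2 <= dot (tau / l2norm c *: b) (noise e o)].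
have mB b : measurable (B b) by apply: mle; exact: measurable_noise_dot.
apply: (@le_trans _ _ (P (B c `|` B (- c)))).
  apply: le_measure; rewrite ?inE.
  - apply/measurable_set_bool/measurable_fun_ltr => //.
    by apply: measurableT_comp => //; exact: measurable_noise_dot.
  - exact: measurableU.
  move=> o /=; rewrite /B /= !dotZl dotNl -!mulrA expr2.
  case: (ger0P (dot c (noise e o))) => ? H; [left|right];
    by rewrite ler_wpM2l// mulrC ler_pdivlMr// mulrC ltW.
apply: (le_trans (measureU2 _ _ _)) => //.
rewrite mulr_natl mulr2n EFinD; apply: leeD; apply: one_sided.
  by rewrite sqr_l2norm.
by rewrite dotNl dotNr opprK sqr_l2norm.
Qed.

(** Chernoff's bound for a chi-squared variable with s degrees of freedom, the law of the quadratic
    form of a projection of rank s. *)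
Lemma chi2_tail (s : nat) (M : 'M[R]_n) (x : R) :
  M^T = M -> M *m M = M -> \tr M = s%:R -> 0 < x ->
  (P [set o | ((Num.sqrt s%:R + Num.sqrt (2 * x)) ^+ 2 <
              dot (noise e o) (M *m noise e o))%R] <= (expR (- x))%:E)%E.
Proof.
move=> Ms Mi Mtr x0; have [s0|s0] := posnP s.
  rewrite (_ : [set _ | _] = set0) ?measure0 ?lee_fin//.
  apply/seteqP; split=> o //=.
  rewrite (projmx_eq0 Ms Mi) ?Mtr ?s0// mul0mx dot0r.
  by rewrite ltNge sqr_ge0.
set u := Num.sqrt s%:R; set w := Num.sqrt (2 * x).
have u0 : 0 < u by rewrite sqrtr_gt0 ltr0n.
have w0 : 0 < w by rewrite sqrtr_gt0 mulr_gt0.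
have uE : u ^+ 2 = s%:R by rewrite sqr_sqrtr.
have wE : w ^+ 2 = 2 * x by rewrite sqr_sqrtr// ltW// mulr_gt0.
(* The minimizer of the exponent in the Chernoff bound. *)
pose th := (1 - (u / (u + w)) ^+ 2) / 2.
have uw0 : 0 < u / (u + w) by rewrite divr_gt0 ?addr_gt0.
have uw1 : u / (u + w) < 1 by rewrite ltr_pdivrMr ?addr_gt0// mul1r ltrDl.
have th0 : 0 <= th.
  by rewrite divr_ge0 ?subr_ge0 ?expr_le1 ?ltW.
have th2 : th < 2^-1.
  by rewrite /th mulrBl mul1r ltrBlDr ltrDl divr_gt0 ?exprn_gt0.
have qE : Num.sqrt (1 - 2 * th) = u / (u + w).
  rewrite (_ : 1 - 2 * th = (u / (u + w)) ^+ 2).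
    by rewrite sqrtr_sqr gtr0_norm.
  by rewrite /th; set k := u / _; field.
pose g o := th * dot (noise e o) (M *m noise e o) + dot 0 (noise e o).
have mg : measurable_fun setT g.
  apply: measurable_funD; last exact: measurable_noise_dot.
  by apply: measurable_funM => //; exact: measurable_noise_quad.
have := integral_expR_quad_noise th0 th2 Ms Mi Mtr (mulmx0 _ _).
move=> /(le_measure_expR (th * (u + w) ^+ 2) mg) H.
apply: (@le_trans _ _ (P [set o | th * (u + w) ^+ 2 <= g o])).
  apply: le_measure; rewrite ?inE.
  - apply/measurable_set_bool/measurable_fun_ltr => //.
    exact: measurable_noise_quad.
  - by apply: measurable_set_bool; exact: measurable_fun_ler.
  move=> o /= H1; rewrite /g dot0l addr0.
  by rewrite ler_wpM2l// ltW.
apply: (le_trans H); rewrite lee_fin qE dot0l mul0r expR0 mulr1.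
have -> : th * (u + w) ^+ 2 = u * w + x.
  rewrite /th; have -> : x = w ^+ 2 / 2 by rewrite wE; field.
  by field; rewrite gt_eqF// addr_gt0.
(* Once exp(-x) is split off, it remains that (1 + w/u)^s <= exp(u w) = exp(w/u)^s, where u^2 = s;
   this follows from 1 + y <= exp y. *)
rewrite invf_div opprD expRD mulrA ler_piMl ?expR_ge0//.
rewrite expRN ler_pdivrMr ?expR_gt0// mul1r.
have -> : expR (u * w) = expR (w / u) ^+ s.
  rewrite -expRM_natr; congr expR; rewrite -uE; field.
  by rewrite gt_eqF.
rewrite ler_pXn2r ?nnegrE ?expR_ge0 ?divr_ge0 ?addr_ge0 ?(ltW u0) ?(ltW w0)//.
by rewrite (le_trans _ (expR_ge1Dx _))// mulrDl divff ?gt_eqF.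
Qed.

End gaussian_tails.

(** * Complements and the union bound *)

Section events.
Context d (T : measurableType d) (R : realType) (P : probability T R).

Lemma prob_ge_setC (B E : set T) (q : R) :
  measurable B -> (P B <= q%:E)%E -> ~` B `<=` E -> prob_ge P E (1 - q).
Proof.
move=> mB PB BE; exists (~` B); split=> //; first exact: measurableC.
by rewrite probability_setC// EFinB; exact: leeB.
Qed.

Lemma union_bound (I : Type) (r : seq I) (B : I -> set T) (q : I -> R) :
  (forall i, measurable (B i)) -> (forall i, (P (B i) <= (q i)%:E)%E) ->
  (P (\big[setU/set0]_(i <- r) B i) <= (\sum_(i <- r) q i)%:E)%E.
Proof.
move=> mB Bq; elim: r => [|i r IH]; first by rewrite !big_nil measure0.
rewrite !big_cons EFinD; apply: (le_trans (measureU2 _ (mB i) _)).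
  exact: bigsetU_measurable.
exact: (leeD (Bq i) IH).
Qed.

End events.

Section noise_event.
Context d (T : measurableType d) (R : realType) (P : probability T R) (n : nat).
Variable e : 'I_n -> {RV P >-> R}.
Hypothesis gauss : iid_std_gaussian e.

Lemma gaussian_event p (c : 'I_p -> 'cV[R]_n) (M : 'M[R]_n) (s : nat)
    (t x : R) :
  M^T = M -> M *m M = M -> \tr M = s%:R -> 0 < t -> 0 < x ->
  prob_ge P
    [set o | (forall j, `|dot (c j) (noise e o)| <= l2norm (c j) * noise_level p t)
           /\ dot (noise e o) (M *m noise e o) <=
              (Num.sqrt s%:R + Num.sqrt (2 * x)) ^+ 2]
    (1 - expR (- t) - expR (- x)).
Proof.
move=> Ms Mi Mtr t0 x0.
pose B j := [set o | l2norm (c j) * noise_level p t < `|dot (c j) (noise e o)|].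
pose B' := [set o | (Num.sqrt s%:R + Num.sqrt (2 * x)) ^+ 2 <
                    dot (noise e o) (M *m noise e o)].
have mlt (f g : T -> R) : measurable_fun setT f -> measurable_fun setT g ->
    measurable [set o | f o < g o].
  by move=> mf mg; apply: measurable_set_bool; exact: measurable_fun_ltr.
have mB j : measurable (B j).
  apply: mlt => //; apply: measurableT_comp => //; exact: measurable_noise_dot.
have mB' : measurable B' by apply: mlt => //; exact: measurable_noise_quad.
have mU : measurable (\big[setU/set0]_j B j) by exact: bigsetU_measurable.
rewrite -addrA -opprD; apply: (prob_ge_setC (B := \big[setU/set0]_j B j `|` B')).
- exact: measurableU.
- apply: (le_trans (measureU2 _ _ _)) => //.
  rewrite EFinD; apply: leeD; last exact: chi2_tail.
  (* The square of [noise_level] is 2 (ln(2p) + t), so the two-sided tail 2 exp(-noise_level^2 / 2)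
     equals exp(-t) / p, and the p events together cost exp(-t). *)
  have Bq j : (P (B j) <= (expR (- t) / p%:R)%:E)%E.
    have p0 : 0 < p%:R :> R by rewrite ltr0n; case: p j {B mB mU c} => // -[].
    apply: (le_trans (gaussian_tail gauss _ _)).
      exact: sqrtr_ge0.
    have lnp : 0 <= ln (2 * p%:R) + t :> R.
      by rewrite addr_ge0 ?(ltW t0)// ln_ge0// -natrM ler1n muln_gt0 /= -(ltr0n R).
    rewrite lee_fin sqr_sqrtr ?mulr_ge0// mulrAC divff// mul1r opprD expRD.
    by rewrite (expRN (ln _)) lnK ?posrE ?mulr_gt0// invfM mulrA mulVKf// mulrC.
  apply: (le_trans (union_bound _ mB Bq)).
  rewrite lee_fin sumr_const card_ord; case: (posnP p) => [->|p0].
    by rewrite mulr0n expR_ge0.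
  by rewrite -[leLHS]mulr_natr divfK// pnatr_eq0 -lt0n.
move=> o /=; rewrite /setC/= not_orP => -[H1 H2]; split; last first.
  by rewrite leNgt; apply/negP.
move=> j; rewrite leNgt; apply/negP => Bj; apply: H1.
by rewrite (bigD1 j)//=; left.
Qed.

End noise_event.

(** * Decomposition of the noise *)

Section hat_matrix.
Context {R : realType} {n p : nat}.
Variables (X : 'M[R]_(n, p)) (S : {set 'I_p}).
Hypothesis gramX : gram X S \in unitmx.

Definition inclmx : 'M[R]_(p, #|S|) := \matrix_(i, k) (i == enum_val k)%:R.

(* The least squares coefficients on [S], padded by zeros. *)
Definition lsmx : 'M[R]_(p, n) := inclmx *m (invmx (gram X S) *m (cols X S)^T).

(** The orthogonal projection on the column span of X_S, written so that [hatmx *m e] is X U. *)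
Definition hatmx : 'M[R]_n := X *m lsmx.

Lemma mulmx_inclmx : X *m inclmx = cols X S.
Proof.
apply/matrixP => i k; rewrite !mxE (bigD1 (enum_val k))//= mxE eqxx mulr1.
by rewrite big1 ?addr0// => j /negPf jk; rewrite mxE jk mulr0.
Qed.

Lemma hatmxE : hatmx = cols X S *m invmx (gram X S) *m (cols X S)^T.
Proof. by rewrite /hatmx /lsmx mulmxA mulmx_inclmx mulmxA. Qed.

Lemma gram_sym : (gram X S)^T = gram X S.
Proof. by rewrite /gram trmx_mul trmxK. Qed.

Lemma hatmx_sym : hatmx^T = hatmx.
Proof. by rewrite hatmxE !trmx_mul trmxK trmx_inv gram_sym mulmxA. Qed.

Lemma hatmx_cols : hatmx *m cols X S = cols X S.
Proof. by rewrite hatmxE -!mulmxA -/(gram X S) mulVmx// mulmx1. Qed.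

Lemma hatmx_idem : hatmx *m hatmx = hatmx.
Proof. by rewrite {2}hatmxE !mulmxA hatmx_cols -hatmxE. Qed.

Lemma mxtrace_hatmx : \tr hatmx = #|S|%:R.
Proof.
by rewrite hatmxE -mulmxA mxtrace_mulC -mulmxA -/(gram X S) mulVmx// mxtrace1.
Qed.

Lemma row_lsmx_off j : j \notin S -> row j lsmx = 0.
Proof.
move=> jS; rewrite /lsmx row_mul (_ : row j inclmx = 0) ?mul0mx//.
apply/rowP => k; rewrite !mxE; case: eqP => // jk.
by rewrite jk enum_valP in jS.
Qed.

(** With G the Gram matrix, these rows come from B = G^-1 X_S^T, and B B^T = G^-1 has the u_j^2 on
    its diagonal. *)
Lemma l2norm_row_lsmx j (jS : j \in S) : l2norm (row j lsmx)^T = uj X jS.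
Proof.
have rowj : row j lsmx =
    row (enum_rank_in jS j) (invmx (gram X S) *m (cols X S)^T).
  rewrite /lsmx row_mul; have -> : row j inclmx = delta_mx 0 (enum_rank_in jS j).
    apply/rowP => k; rewrite !mxE eqxx /=; congr (nat_of_bool _)%:R.
    apply/eqP/eqP => [E|->]; last by rewrite enum_rankK_in.
    by rewrite -[LHS](enum_valK_in jS) -E.
  by rewrite -rowE.
set B := invmx _ *m _ in rowj; set k := enum_rank_in jS j in rowj.
rewrite l2normE rowj /uj; congr Num.sqrt.
transitivity ((B *m B^T) k k).
  by rewrite dot_sum mxE; apply: eq_bigr => i _; rewrite !mxE.
rewrite /B trmx_mul trmxK trmx_inv gram_sym -mulmxA [_^T *m _]mulmxA -/(gram X S).
by rewrite mulmxV// mulmx1.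
Qed.

Definition residual j : 'cV[R]_n := col j X - orth_proj (cols X S) (col j X).

Lemma cols_residual j : (cols X S)^T *m residual j = 0.
Proof. exact: (orth_projP (cols X S) (col j X)).2. Qed.

Lemma hatmx_residual j : hatmx *m residual j = 0.
Proof. by rewrite hatmxE -mulmxA cols_residual mulmx0. Qed.

(** Identifies [hatmx] with [orth_proj] on the columns of X: it fixes the part in the span of X_S
    and kills the residual. *)
Lemma hatmx_col j : hatmx *m col j X = col j X - residual j.
Proof.
have [/submxP[D DE] _] := orth_projP (cols X S) (col j X).
rewrite -{1}(subrK (residual j) (col j X)) mulmxDr hatmx_residual addr0.
rewrite /residual opprB addrC subrK.
by rewrite -[orth_proj _ _]trmxK DE trmx_mul trmxK mulmxA hatmx_cols.
Qed.

Definition off_noise (e : 'cV[R]_n) : 'cV[R]_p :=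
  restr (~: S)%SET (\col_j dot (residual j) e).

(** Split e into its projection H e = X U and e - H e. The column j of X pairs with the latter as
    the residual of column j pairs with e, and this residual vanishes for j in S. *)
Lemma noise_decomp e : X^T *m e = X^T *m X *m (lsmx *m e) + off_noise e.
Proof.
apply/colP => j.
have XTE (f : 'cV[R]_n) : (X^T *m f) j 0 = dot (col j X) f.
  by rewrite dot_sum mxE; apply: eq_bigr => i _; rewrite !mxE.
rewrite [RHS]mxE -[X^T *m X *m _]mulmxA [X *m (lsmx *m e)]mulmxA -/hatmx !XTE.
rewrite dot_mulmx hatmx_sym hatmx_col dotBl /off_noise !mxE inE.
case: ifPn => [_|/negbNE jS]; first by rewrite subrK.
have -> : residual j = col j X - hatmx *m col j X.
  by rewrite hatmx_col opprB addrC subrK.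
have -> : col j X = cols X S *m delta_mx (enum_rank_in jS j) 0.
  by rewrite -colE; apply/colP => i; rewrite !mxE enum_rankK_in.
by rewrite mulmxA hatmx_cols subrr dot0l subr0 addr0.
Qed.

End hat_matrix.

(** * Optimality conditions of the Lasso *)

Section deterministic.
Context {R : realType}.

(** Replaces the limit tau -> 0 in first-order optimality arguments; [m] restricts the admissible
    steps to tau m <= 1. *)
Lemma le0_small_mul (a b m : R) : 0 <= m ->
  (forall tau, 0 < tau -> tau * m <= 1 -> a <= tau * b) -> a <= 0.
Proof.
move=> m0 H; rewrite leNgt; apply/negP => a0.
have k0 : 0 < a + a * m + `|b| + 1.
  by rewrite ltr_wpDl// !addr_ge0// ?(ltW a0)// mulr_ge0// ltW.
(* This step satisfies both tau m <= 1 and tau b < a. *)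
have := H (a / (a + a * m + `|b| + 1)).
rewrite divr_gt0// => /(_ isT).
have -> : a / (a + a * m + `|b| + 1) * m <= 1.
  rewrite mulrAC ler_pdivrMr// mul1r; have := normr_ge0 b; lra.
move=> /(_ isT); rewrite mulrAC ler_pdivlMr//.
rewrite ler_pM2l//; have := ler_norm b; have : 0 <= a * m by rewrite mulr_ge0// ltW.
lra.
Qed.

Context {n p : nat}.
Implicit Types (X : 'M[R]_(n, p)) (S : {set 'I_p}) (b c w z : 'cV[R]_p).

Lemma l1normZ a b : l1norm (a *: b) = `|a| * l1norm b.
Proof. by rewrite mulr_sumr; apply: eq_bigr => j _; rewrite mxE normrM. Qed.

Lemma l1normD b c : l1norm (b + c) <= l1norm b + l1norm c.
Proof. by rewrite -big_split; apply: ler_sum => j _; rewrite mxE ler_normD. Qed.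

Lemma l1norm_restr S b : l1norm (restr S b) = \sum_(j in S) `|b j 0|.
Proof.
rewrite [RHS]big_mkcond; apply: eq_bigr => j _; rewrite mxE.
by case: ifP; rewrite ?normr0.
Qed.

Lemma dot_restr S z b : dot z (restr S b) = \sum_(j in S) z j 0 * b j 0.
Proof.
rewrite dot_sum [RHS]big_mkcond; apply: eq_bigr => j _; rewrite mxE.
by case: ifP; rewrite ?mulr0.
Qed.

Lemma wl1_offE S w b : wl1_off S w b = \sum_(j | j \notin S) `|w j 0 * b j 0|.
Proof.
rewrite [RHS]big_mkcond; apply: eq_bigr => j _; rewrite mul_diag_mx !mxE inE.
by case: ifP; rewrite // mulr0 normr0.
Qed.

(** Compare b with b + tau c: by convexity the l1 norm grows at most linearly in tau along the
    segment, and the quadratic term is of order tau^2. *)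
Lemma lasso_variational X (Y : 'cV[R]_n) lam b c : 0 <= lam ->
  lasso X Y lam b ->
  dot (Y - X *m b) (X *m c) <= lam * (l1norm (b + c) - l1norm b).
Proof.
move=> lam0 [_ /= bmin]; rewrite -subr_le0.
apply: (le0_small_mul (b := dot (X *m c) (X *m c) / 2) (m := 1)) => // tau t0.
rewrite mulr1 => t1; have := bmin (b + tau *: c) I.
rewrite !sqr_l2norm mulmxDr -scalemxAr opprD addrA; move: (Y - _) => r.
rewrite [dot (r - _) _]dotBl !dotBr !dotZl !dotZr (dotC (X *m c) r).
have : l1norm (b + tau *: c) <= (1 - tau) * l1norm b + tau * l1norm (b + c).
  have -> : b + tau *: c = (1 - tau) *: b + tau *: (b + c).
    by rewrite scalerBl scale1r scalerDr addrA subrK.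
  apply: (le_trans (l1normD _ _)).
  by rewrite !l1normZ !ger0_norm ?subr_ge0// ltW.
set A := dot r r; set B := dot r (X *m c).
set C := dot (X *m c) _; set L := l1norm (b + tau *: c).
set L1 := l1norm b; set L2 := l1norm (b + c) => H1 H2.
rewrite -(ler_pM2l t0).
have : lam * L <= lam * ((1 - tau) * L1 + tau * L2) by rewrite ler_wpM2l.
lra.
Qed.

Lemma mx_norm_leP b (a : R) : 0 <= a ->
  mx_norm b <= a <-> forall j, `|b j 0| <= a.
Proof.
move=> a0; rewrite mx_normrE; split=> [/bigmax_leP[_ H] j|H].
  exact: (H (j, 0)).
by apply/bigmax_leP; split=> // -[j i] _; rewrite ord1; exact: H.
Qed.

(** The terms |b_j| - z_j b_j are nonnegative and sum to zero. *)
Lemma subdiff_l1_coord b z : subdiff_l1 b z ->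
  forall j, `|z j 0| <= 1 /\ z j 0 * b j 0 = `|b j 0|.
Proof.
move=> [/eqP zb z1].
have z1j j : `|z j 0| <= 1 by move: j; apply/mx_norm_leP.
move: zb; rewrite -/(dot z b) dot_sum eq_sym -subr_eq0 -sumrB.
move=> /eqP /psumr_eq0P zb j; split=> //; apply/esym/eqP; rewrite -subr_eq0.
apply/eqP; apply: zb => // k _; rewrite subr_ge0.
by rewrite (le_trans (ler_norm _))// normrM ler_piMl.
Qed.

Lemma lasso_sub_kkt X beta0 (e : 'cV[R]_n) lam : 0 < lam ->
  lasso X (X *m beta0 + e) lam `<=` lasso_kkt X beta0 e lam.
Proof.
move=> lam0 b bL.
have var c := lasso_variational c (ltW lam0) bL.
set r := _ - X *m b in var.
(* The KKT equation forces this subgradient; [lasso_variational] will show that it is one. *)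
exists (lam^-1 *: (X^T *m r)); last first.
  rewrite scalerA divff ?gt_eqF// scale1r /r -mulmxA -mulmxDr; congr (_ *m _).
  by rewrite mulmxBr -[_ + e - _]addrA subrKA addrCA subrr addr0.
have var' c : dot (lam^-1 *: (X^T *m r)) c <= l1norm (b + c) - l1norm b.
  by rewrite dotZl -dot_mulmx -(ler_pM2l lam0) mulrA divff ?gt_eqF// mul1r.
move: (lam^-1 *: _) var' => z var'; split; last first.
  apply/mx_norm_leP => // j.
  (* Directions along a coordinate axis, with a = 1 and a = -1, bound |z_j|. *)
  have dz (a : R) : a * z j 0 <= `|a|.
    have -> : a * z j 0 = dot z (a *: delta_mx j 0).
      rewrite dotZr dot_sum (bigD1 j)//= mxE !eqxx mulr1 big1 ?addr0// => i /negPf ij.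
      by rewrite mxE ij mulr0.
    have -> : `|a| = l1norm (a *: delta_mx j 0 : 'cV[R]_p).
      rewrite l1normZ /l1norm (bigD1 j)//= mxE !eqxx normr1 big1 ?addr0 ?mulr1//.
      by move=> i /negPf ij; rewrite mxE ij normr0.
    apply: (le_trans (var' _)); rewrite lerBlDl; exact: l1normD.
  by rewrite ler_norml; have := dz 1; have := dz (-1); rewrite normrN1 normr1; lra.
(* The directions b and -b give the two inequalities between z.b and |b|_1. *)
apply/eqP; rewrite -/(dot z b) eq_le; apply/andP; split.
  have := var' b; rewrite -mulr2n -scaler_nat l1normZ ger0_norm//; lra.
have := var' (- b); rewrite subrr dotNr /l1norm.
by rewrite big1 ?sub0r ?lerN2// => j _; rewrite mxE normr0.
Qed.

End deterministic.

(** * Existence of a Lasso solution *)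

Lemma continuous_sum (R : realType) (V : topologicalType) (I : Type)
    (r : seq I) (f : I -> V -> R) :
  (forall i, continuous (f i)) -> continuous (fun x => \sum_(i <- r) f i x).
Proof.
move=> cf; elim: r => [|i r IH].
  rewrite (_ : (fun x => _) = cst 0); first exact: cst_continuous.
  by apply/funext => x; rewrite big_nil.
rewrite (_ : (fun x => _) = (fun x => f i x + \sum_(j <- r) f j x)); last first.
  by apply/funext => x; rewrite big_cons.
by move=> x; apply: cvgD; [exact: cf|exact: IH].
Qed.

Lemma lasso_nonempty (R : realType) n p (X : 'M[R]_(n, p)) (Y : 'cV[R]_n) lam :
  0 < lam -> lasso X Y lam !=set0.
Proof.
move=> lam0.
pose f (b : 'cV[R]_p) := l2norm (Y - X *m b) ^+ 2 + 2 * lam * l1norm b.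
have cf : continuous (fun b : 'rV[R]_p => f b^T).
  have cb j : continuous (fun b : 'rV[R]_p => b^T j 0).
    rewrite (_ : (fun b => _) = (fun b : 'rV[R]_p => b 0 j)); last first.
      by apply/funext => b; rewrite mxE.
    exact: coord_continuous.
  have cX i : continuous (fun b : 'rV[R]_p => (Y - X *m b^T) i 0).
    rewrite (_ : (fun b => _) =
        (fun b : 'rV[R]_p => Y i 0 - \sum_j X i j * b^T j 0)); last first.
      by apply/funext => b; rewrite !mxE.
    move=> b; apply: (@cvgB _ _ _ (nbhs b)); first exact: cvg_cst.
    apply: continuous_sum => j c; apply: (@cvgM _ _ (nbhs c)); first exact: cvg_cst.
    exact: cb.
  rewrite (_ : (fun b => _) = (fun b : 'rV[R]_p =>
    \sum_i (Y - X *m b^T) i 0 * (Y - X *m b^T) i 0 +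
    2 * lam * \sum_j `|b^T j 0|)); last first.
    by apply/funext => b; rewrite /f sqr_l2norm dot_sum.
  move=> b; apply: (@cvgD _ _ _ (nbhs b)).
    apply: continuous_sum => i c; apply: (@cvgM _ _ (nbhs c)); exact: cX.
  apply: (@cvgM _ _ (nbhs b)); first exact: cvg_cst.
  apply: continuous_sum => j c; apply: continuous_comp; first exact: cb.
  exact: norm_continuous.
(* Outside the sup-norm ball of radius [r] the penalty alone exceeds [f 0], so a minimizer on this
   compact ball is global. *)
pose r := f 0 / (2 * lam).
have lam2 : 0 < 2 * lam by rewrite mulr_gt0.
have r0 : 0 <= r.
  rewrite divr_ge0 ?(ltW lam2)// /f addr_ge0 ?sqr_ge0// mulr_ge0 ?(ltW lam2)//.
  exact: sumr_ge0.
pose A : set 'rV[R]_p := [set b | `|b| <= r].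
have A0 : A 0 by rewrite /A/= normr0.
have cA : compact A.
  apply: bounded_closed_compact.
    exists r; split; first exact: num_real.
    by move=> M rM b /= bA; exact: (le_trans bA (ltW rM)).
  have -> : A = (fun b : 'rV[R]_p => `|b|) @^-1` [set x : R | x <= r] by [].
  apply: closed_comp; last exact: closed_le.
  by move=> b _; exact: norm_continuous.
have [c cA' cmin] := EVT_min_rV (ex_intro _ _ A0) cA (continuous_subspaceT cf).
exists c^T; split=> // b _; rewrite -/(f b) -/(f c^T).
have [bA|bA] := leP `|b^T| r.
  by rewrite -[b]trmxK cmin// inE.
apply: (@le_trans _ _ (f 0)); first by rewrite -trmx0 cmin// inE.
have nb : `|b^T| <= l1norm b.
  rewrite [leLHS]mx_normrE; apply/bigmax_leP; split; first exact: sumr_ge0.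
  move=> [i j] _ /=; rewrite ord1 mxE /l1norm (bigD1 j)//= lerDl.
  exact: sumr_ge0.
apply: ltW; apply: (lt_le_trans (_ : _ < 2 * lam * l1norm b)); last first.
  by rewrite lerDr sqr_ge0.
by rewrite -ltr_pdivrMl// mulrC (lt_le_trans bA).
Qed.

(** By superadditivity and homogeneity of h, the point (b + tau c) / (1 + tau h(c)) is feasible;
    comparing it with b to first order in tau gives the claim. *)
Lemma homogeneous_argmin_variational (R : realType) n p (X : 'M[R]_(n, p))
    (h : 'cV[R]_p -> R) (b c : 'cV[R]_p) :
  (forall b1 b2, h b1 + h b2 <= h (b1 + b2)) ->
  (forall a b1, 0 <= a -> h (a *: b1) = a * h b1) ->
  argmin [set b1 | 1 <= h b1] (fun b1 => l2norm (X *m b1) ^+ 2) b ->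
  h c * dot (X *m b) (X *m b) <= dot (X *m b) (X *m c).
Proof.
move=> hD hZ [/= hb bmin]; rewrite -subr_le0.
set A := dot _ (X *m c); set C := dot (X *m b) _; set B := dot (X *m c) (X *m c).
apply: (le0_small_mul (b := B / 2) (m := 2 * `|h c|)); first by rewrite mulr_ge0.
move=> tau t0 t1.
(* The restriction 2 tau |h(c)| <= 1 keeps the denominator at least 1/2. *)
have hc : 0 < 1 + tau * h c.
  have : tau * - h c <= tau * `|h c| by rewrite ler_pM2l// -normrN ler_norm.
  lra.
have := bmin ((1 + tau * h c)^-1 *: (b + tau *: c)).
rewrite !sqr_l2norm -scalemxAr dotZl dotZr mulmxDr -scalemxAr.
rewrite !(dotDl, dotDr, dotZl, dotZr) (dotC (X *m c)) -/A -/B -/C.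
have -> : 1 <= h ((1 + tau * h c)^-1 *: (b + tau *: c)).
  rewrite hZ ?invr_ge0 ?(ltW hc)// mulrC ler_pdivlMr// mul1r.
  apply: le_trans (hD _ _); rewrite hZ ?(ltW t0)//; lra.
move=> /(_ isT); rewrite mulrA -invfM mulrC ler_pdivlMr ?mulr_gt0// => H.
have C0 : 0 <= C by exact: dot_ge0.
have : 0 <= tau * tau * (h c * h c) * C.
  by rewrite mulr_ge0// mulr_ge0// -expr2 sqr_ge0.
by move=> H'; rewrite -(ler_pM2l t0); lra.
Qed.

(** * Deterministic bounds *)

Section signed_gap.
Context {R : realType} {p : nat}.
Implicit Types (S : {set 'I_p}) (w b c z : 'cV[R]_p).

Definition l1gap S w b : R := l1norm (restr S b) - wl1_off S w b.

(** The constraint function of [bw_set]. Fixing the signs on S makes it superadditive, hence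
    concave, which [l1gap] is not in general. *)
Definition signed_gap S z w b : R := dot z (restr S b) - wl1_off S w b.

Lemma l1gapZ S w a b : 0 <= a -> l1gap S w (a *: b) = a * l1gap S w b.
Proof.
move=> a0; rewrite /l1gap !l1norm_restr !wl1_offE mulrBr !mulr_sumr.
congr (_ - _); apply: eq_bigr => j _; rewrite !mxE.
  by rewrite normrM ger0_norm.
by rewrite mulrCA normrM ger0_norm.
Qed.

Lemma signed_gapZ S z w a b :
  0 <= a -> signed_gap S z w (a *: b) = a * signed_gap S z w b.
Proof.
move=> a0; rewrite /signed_gap !dot_restr !wl1_offE mulrBr !mulr_sumr.
congr (_ - _); apply: eq_bigr => j _; rewrite !mxE mulrCA//.
by rewrite normrM ger0_norm.
Qed.

Lemma signed_gapD S z w b c :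
  signed_gap S z w b + signed_gap S z w c <= signed_gap S z w (b + c).
Proof.
rewrite /signed_gap addrACA -opprD; apply: lerB.
  rewrite !dot_restr -big_split; apply: ler_sum => j _ /=.
  by rewrite !mxE mulrDr.
rewrite !wl1_offE -big_split; apply: ler_sum => j _ /=.
by rewrite !mxE mulrDr ler_normD.
Qed.

Lemma sum_split S (F : 'I_p -> R) :
  \sum_j F j = \sum_(j in S) F j + \sum_(j | j \notin S) F j.
Proof. by rewrite (bigID (mem S)). Qed.

End signed_gap.

Section bounds.
Context {R : realType} {n p : nat}.
Variables (X : 'M[R]_(n, p)) (beta0 : 'cV[R]_p) (e : 'cV[R]_n) (lam : R).
Variables (U V v : 'cV[R]_p).
Let S := supp beta0.
Hypothesis lam0 : 0 < lam.
Hypothesis eUV : X^T *m e = X^T *m X *m U + V.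
Hypothesis U_off : forall j, j \notin S -> U j 0 = 0.
Hypothesis V_on : forall j, j \in S -> V j 0 = 0.
Hypothesis V_off : forall j, j \notin S -> `|V j 0| <= lam * v j 0.
Hypothesis v1 : forall j, j \notin S -> v j 0 < 1.

Lemma beta0_off j : j \notin S -> beta0 j 0 = 0.
Proof. by rewrite inE negbK => /eqP. Qed.

Lemma minus1_off j : j \notin S -> minus1 S v j 0 = 1 - v j 0.
Proof. by move=> jS; rewrite !mxE inE jS. Qed.

Lemma plus1_off j : j \notin S -> plus1 S v j 0 = 1 + v j 0.
Proof. by move=> jS; rewrite !mxE inE jS. Qed.

(** The variational inequality in the direction beta0 - b. The part U of the noise is handled by
    Cauchy-Schwarz, while V acts only off S. *)
Lemma lasso_sqr_error b : lasso X (X *m beta0 + e) lam b ->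
  l2norm (X *m (b - beta0)) ^+ 2 <=
  l2norm (X *m U) * l2norm (X *m (b - beta0)) +
  lam * l1gap S (minus1 S v) (b - beta0).
Proof.
move=> bL; set d := b - beta0.
have := lasso_variational (- d) (ltW lam0) bL.
rewrite (_ : b - d = beta0); last by rewrite /d opprB addrC subrK.
have -> : X *m beta0 + e - X *m b = e - X *m d by rewrite mulmxBr opprB addrCA addrA.
rewrite mulmxN dotNr dotBl opprB -sqr_l2norm dot_mulmx eUV dotDl.
rewrite -mulmxA -dot_mulmx => H.
have HU := dot_le_l2norm (X *m U) (X *m d).
suff : dot V d + lam * (l1norm beta0 - l1norm b) <= lam * l1gap S (minus1 S v) d by lra.
rewrite /l1gap l1norm_restr wl1_offE dot_sum /l1norm.
rewrite !(sum_split S).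
rewrite [X in X + _ + _]big1 ?add0r; last by move=> j jS; rewrite V_on// mul0r.
have H1 : \sum_(j in S) `|beta0 j 0| <=
    \sum_(j in S) `|b j 0| + \sum_(j in S) `|d j 0|.
  rewrite -big_split; apply: ler_sum => j _ /=; rewrite /d !mxE.
  by rewrite -{1}(subKr (b j 0) (beta0 j 0)) (le_trans (ler_normB _ _)).
have H2 : \sum_(j | j \notin S) `|beta0 j 0| = 0.
  by apply: big1 => j jS; rewrite beta0_off// normr0.
(* Off S, d_j = b_j, and V_j uses up the share v_j of the unit weight of the penalty, leaving 1 -
   v_j. *)
have H3 : \sum_(j | j \notin S) V j 0 * d j 0 +
    lam * \sum_(j | j \notin S) `|minus1 S v j 0 * d j 0| <=
    lam * \sum_(j | j \notin S) `|b j 0|.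
  rewrite !mulr_sumr -big_split; apply: ler_sum => j jS /=.
  rewrite minus1_off// /d !mxE beta0_off// subr0 normrM.
  rewrite ger0_norm ?subr_ge0 ?(ltW (v1 jS))//.
  have : V j 0 * b j 0 <= lam * v j 0 * `|b j 0|.
    by rewrite (le_trans (ler_norm _))// normrM ler_wpM2r// V_off.
  lra.
rewrite H2.
have := ler_wpM2l (ltW lam0) H1; lra.
Qed.

(** Moving U to the left turns the KKT equation into X^T X D = V - lam zeta for D = b - beta0 -
    U. *)
Lemma kkt_dot b zeta (c : 'cV[R]_p) :
  X^T *m X *m (b - beta0) + lam *: zeta = X^T *m e ->
  dot (X *m (b - beta0 - U)) (X *m c) = dot (V - lam *: zeta) c.
Proof.
move=> kkt; rewrite dot_mulmx mulmxA mulmxBr.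
have -> : X^T *m X *m (b - beta0) = X^T *m X *m U + V - lam *: zeta.
  by rewrite -eUV -kkt addrK.
by congr (dot _ c); apply/eqP; rewrite subr_eq [eqbRHS]addrC addrA.
Qed.

(* Chosen so that [zeta_j - V_j / lam] is a subgradient of [w_j |.|] at the
   coordinate [j] of the solution; the maximum only matters when that coordinate
   is zero, and keeps [w] within [weights S v]. *)
Definition kkt_weights (zeta : 'cV[R]_p) : 'cV[R]_p :=
  restr (~: S)%SET
    (\col_j Num.max `|zeta j 0 - V j 0 / lam| (1 - v j 0) : 'cV[R]_p).

Lemma kkt_weightsP b zeta : subdiff_l1 b zeta -> weights S v (kkt_weights zeta).
Proof.
move=> /subdiff_l1_coord zb j; rewrite !mxE finset.in_setC.
have [//|jS] /= := boolP (j \in S).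
have Vj : `|V j 0 / lam| <= v j 0.
  by rewrite normrM normfV (gtr0_norm lam0) ler_pdivrMr// mulrC V_off.
have v0 : 0 <= v j 0 by rewrite (le_trans _ Vj).
rewrite le_max lexx orbT/= ge_max.
rewrite (le_trans (ler_normB _ _)) ?lerD// ?(zb j).1//=.
lra.
Qed.

Lemma kkt_fit b zeta z (bw : 'cV[R]_p) :
  subdiff_l1 b zeta ->
  X^T *m X *m (b - beta0) + lam *: zeta = X^T *m e ->
  bw_set X S z (kkt_weights zeta) bw ->
  X *m bw != 0 ->
  (forall j, j \in S -> z j 0 = Num.sg (beta0 j 0)) ->
  (forall j, j \in S ->
     `|U j 0| + lam * `|bw j 0| / l2norm (X *m bw) ^+ 2 <= `|beta0 j 0|) ->
  l2norm (X *m (b - beta0 - U)) = lam / l2norm (X *m bw).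
Proof.
move=> zb kkt bwmin bw0 zS betamin; have zbc := subdiff_l1_coord zb.
set D := b - beta0 - U; set w := kkt_weights zeta in bwmin.
set C := l2norm (X *m bw) ^+ 2.
have C0 : 0 < C by rewrite exprn_gt0// lt_def l2norm_ge0 l2norm_eq0 bw0.
pose h := signed_gap S z w.
have var c : h c * C <= dot (X *m bw) (X *m c).
  rewrite /C sqr_l2norm.
  apply: homogeneous_argmin_variational bwmin; first exact: signed_gapD.
  exact: signed_gapZ.
(* Scaled so that the optimality of [bw] reads lam h(c) <= Xa.Xc for every c. *)
pose a := (lam / C) *: bw.
have lamC : 0 < lam / C by rewrite divr_gt0.
have ha : dot (X *m a) (X *m a) <= lam * h a.
  rewrite /a -!scalemxAr dotZl dotZr -sqr_l2norm -/C /h signed_gapZ ?(ltW lamC)//.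
  rewrite divfK ?gt_eqF// mulrC ler_pM2l// ler_peMr ?(ltW lamC)//.
  exact: bwmin.1.
have hD : lam * h (- D) <= - dot (X *m D) (X *m a).
  rewrite /a -!scalemxAr dotZr -mulrN -ler_pdivrMl//.
  rewrite invfM invrK mulrACA mulVf ?gt_eqF// mul1r mulrC (le_trans (var _))//.
  by rewrite mulmxN dotNr dotC.
have KKT c : dot (X *m D) (X *m c) = dot (V - lam *: zeta) c by exact: kkt_dot.
(* Off S, zeta_j - V_j / lam is a subgradient of w_j |.| at D_j: its product with D_j is at least
   w_j |D_j|, and with any c_j at least -w_j |c_j|. *)
have [D1 D2] : dot (X *m D) (X *m D) <=
      - lam * (\sum_(j in S) zeta j 0 * D j 0 + wl1_off S w D)
   /\ forall c, dot (X *m D) (X *m c) <=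
      - lam * (\sum_(j in S) zeta j 0 * c j 0 - wl1_off S w c).
  have wE j : j \notin S ->
      w j 0 = Num.max `|zeta j 0 - V j 0 / lam| (1 - v j 0).
    by move=> jS; rewrite !mxE inE jS.
  have VE j : (V - lam *: zeta) j 0 = - lam * (zeta j 0 - V j 0 / lam).
    by rewrite !mxE; field; rewrite gt_eqF.
  have w0 j : j \notin S -> 0 <= w j 0 by move=> jS; rewrite wE// le_max normr_ge0.
  have on c : \sum_(j in S) (V - lam *: zeta) j 0 * c j 0 =
      - lam * \sum_(j in S) zeta j 0 * c j 0.
    rewrite mulr_sumr; apply: eq_bigr => j jS; rewrite !mxE V_on// sub0r.
    by ring.
  split=> [|c]; rewrite KKT dot_sum (sum_split S) on wl1_offE mulrDr lerD2l.
    rewrite mulr_sumr; apply: ler_sum => j jS; rewrite VE -mulrA.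
    rewrite !mulNr lerN2 ler_pM2l// normrM (ger0_norm (w0 _ jS)) wE//.
    have Dj : D j 0 = b j 0 by rewrite !mxE beta0_off// U_off// !subr0.
    set sg := _ - _ / _.
    (* Off S, zeta_j D_j = |D_j|. The bound settles the case w_j = 1 - v_j and, as it makes sg D_j
       nonnegative, also the case w_j = |sg|. *)
    have sgD : (1 - v j 0) * `|D j 0| <= sg * D j 0.
      have VD : V j 0 / lam * D j 0 <= v j 0 * `|D j 0|.
        rewrite (le_trans (ler_norm _))// normrM ler_wpM2r//.
        rewrite normrM normfV (gtr0_norm lam0) ler_pdivrMr// mulrC.
        exact: V_off.
      have := (zbc j).2; rewrite -Dj /sg; lra.
    case: (leP `|sg|) => // _; rewrite -normrM ger0_norm//.
    by rewrite (le_trans _ sgD)// mulr_ge0// subr_ge0 ltW// v1.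
  rewrite mulrN mulNr opprK mulr_sumr; apply: ler_sum => j jS.
  rewrite VE -mulrA mulNr -mulrN ler_pM2l// -mulNr.
  rewrite (le_trans (ler_norm _))// !normrM ler_wpM2r// normrN.
  by rewrite (ger0_norm (w0 _ jS)) wE// le_max lexx.
(* Then XD = -Xa, and |Xa| = lam / |X bw|. *)
suff : dot (X *m (D + a)) (X *m (D + a)) <= 0.
  move=> Da0; have : X *m (D + a) == 0 by rewrite -dot_eq0 eq_le Da0 dot_ge0.
  rewrite mulmxDr addr_eq0 => /eqP ->; rewrite l2normN /a -scalemxAr l2normZ.
  by rewrite gtr0_norm// /C; field; rewrite l2norm_eq0.
(* Write D + a = b - (beta0 - (a - U)). On S, (z_j - zeta_j) b_j <= 0 because zeta_j b_j = |b_j|; by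
   betamin, z_j (beta0_j - (a_j - U_j)) >= 0, and z_j - zeta_j is a nonnegative multiple of z_j. *)
have sgn : \sum_(j in S) (z j 0 - zeta j 0) * (D j 0 + a j 0) <= 0.
  apply: sumr_le0 => j jS; have zj := zS j jS; have [zj1 zjb] := zbc j.
  have b0 : `|beta0 j 0| = z j 0 * beta0 j 0 by rewrite zj -normrEsg.
  have z2 : z j 0 * z j 0 = 1.
    rewrite zj -expr2 sqr_sg; move: jS; rewrite inE => ->.
    by [].
  have z1 : `|z j 0| = 1 by rewrite zj normr_sg; move: jS; rewrite inE => ->.
  have t0 : 0 <= 1 - zeta j 0 * z j 0.
    by rewrite subr_ge0 (le_trans (ler_norm _))// normrM z1 mulr1.
  have t1 : z j 0 * (a j 0 - U j 0) <= `|beta0 j 0|.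
    apply: le_trans (betamin j jS); rewrite (le_trans (ler_norm _))//.
    rewrite normrM z1 mul1r (le_trans (ler_normB _ _))// addrC lerD2l.
    by rewrite mxE normrM (gtr0_norm lamC) mulrAC.
  have t2 : z j 0 * b j 0 <= `|b j 0|.
    by rewrite (le_trans (ler_norm _))// normrM z1 mul1r.
  have -> : D j 0 = b j 0 - beta0 j 0 - U j 0 by rewrite !mxE.
  have zz : z j 0 - zeta j 0 = (1 - zeta j 0 * z j 0) * z j 0.
    by rewrite mulrBl mul1r -mulrA z2 mulr1.
  have p2 : 0 <= (z j 0 - zeta j 0) * (beta0 j 0 - (a j 0 - U j 0)).
    by rewrite zz -mulrA mulrBr -b0 mulr_ge0// subr_ge0.
  lra.
(* Adding [ha], [hD], [D1] and [D2 a], the weighted l1 terms of D and of a cancel. *)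
rewrite mulmxDr !(dotDl, dotDr) (dotC (X *m a)).
move: ha hD; rewrite /h /signed_gap !dot_restr.
rewrite (_ : wl1_off S w (- D) = wl1_off S w D); last first.
  by rewrite !wl1_offE; apply: eq_bigr => j _; rewrite [(- D) j 0]mxE mulrN normrN.
have -> : \sum_(j in S) z j 0 * (- D) j 0 = - \sum_(j in S) z j 0 * D j 0.
  by rewrite -sumrN; apply: eq_bigr => j _; rewrite [(- D) j 0]mxE mulrN.
move=> ha hD; have := D2 a.
have : lam * \sum_(j in S) (z j 0 - zeta j 0) * (D j 0 + a j 0) <= 0.
  by rewrite pmulr_rle0.
have -> : \sum_(j in S) (z j 0 - zeta j 0) * (D j 0 + a j 0) =
    \sum_(j in S) z j 0 * D j 0 + \sum_(j in S) z j 0 * a j 0 -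
    (\sum_(j in S) zeta j 0 * D j 0 + \sum_(j in S) zeta j 0 * a j 0).
  rewrite -!big_split -sumrB; apply: eq_bigr => j _ /=; ring.
lra.
Qed.

End bounds.

(** * The compatibility constant and the main term *)

Section main_term.
Context {R : realType} {n p : nat}.
Variables (X : 'M[R]_(n, p)) (S : {set 'I_p}) (w : 'cV[R]_p) (lam : R).

Lemma kappa2_ge0 : (0 <= kappa2 X w S)%E.
Proof.
apply: le_ereal_inf_tmp => _ [b _ <-]; rewrite lee_fin divr_ge0//.
by rewrite mulr_ge0// sqr_ge0.
Qed.

Lemma main_term_ge0 : (0 <= main_term X w S lam)%E.
Proof. by rewrite mule_ge0 ?sqrte_ge0// lee_fin. Qed.

Let sqrt_ratio (r : R) : (0 < #|S|)%N -> (0 < n)%N -> 0 < r -> 0 < lam ->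
  (sqrte (#|S|%:R%:E / (#|S|%:R * r ^+ 2 / n%:R)%:E) *
   (Num.sqrt (lam ^+ 2 / n%:R))%:E = (lam / r)%:E)%E.
Proof.
rewrite -!(ltr0n R) => S0 n0 r0 lam0.
have k0 : #|S|%:R * r ^+ 2 / n%:R != 0 :> R.
  by rewrite gt_eqF// divr_gt0// mulr_gt0// exprn_gt0.
rewrite inver (negbTE k0) -EFinM -sqrtrM; last first.
  by rewrite ltW// divr_gt0// divr_gt0// mulr_gt0// exprn_gt0.
rewrite [X in Num.sqrt X](_ : _ = (lam / r) ^+ 2).
  by rewrite sqrtr_sqr gtr0_norm ?divr_gt0.
by field; rewrite !gt_eqF.
Qed.

(** b divided by its gap lies in the slice, so its value bounds [kappa2] from above; a positive gap
    also forces S to be nonempty. *)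
Lemma le_main_term (b : 'cV[R]_p) : (0 < n)%N -> 0 < lam ->
  X *m b != 0 -> 0 < l1gap S w b ->
  ((lam * l1gap S w b / l2norm (X *m b))%:E <= main_term X w S lam)%E.
Proof.
move=> n0 lam0 Xb0 q0; set q := l1gap S w b in q0 *.
have E0 : 0 < l2norm (X *m b) by rewrite lt_def l2norm_ge0 l2norm_eq0 Xb0.
have S0 : (0 < #|S|)%N.
  rewrite lt0n; apply: contraTneq q0 => /cards0_eq S0; rewrite -leNgt.
  rewrite /q /l1gap l1norm_restr wl1_offE S0 big_set0 sub0r oppr_le0.
  exact: sumr_ge0.
rewrite -mulrA -[q / _]invrK -sqrt_ratio ?invr_gt0 ?divr_gt0//.
rewrite invf_div lee_wpmul2r ?lee_fin//.
rewrite lee_sqrt ?mule_ge0 ?inve_ge0 ?kappa2_ge0 ?lee_fin//.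
rewrite lee_wpmul2l ?lee_fin// lee_pV2 ?inE ?kappa2_ge0//; last first.
  by rewrite lee_fin divr_ge0// mulr_ge0// sqr_ge0.
apply: ereal_inf_lbound; exists (q^-1 *: b).
  by rewrite /slice/= -/(l1gap S w _) l1gapZ ?invr_ge0 ?(ltW q0)// mulVf// gt_eqF.
by rewrite -scalemxAr l2normZ gtr0_norm ?invr_gt0// [q^-1 * _]mulrC.
Qed.

(** The minimizer b bounds [kappa2] on both sides. Positivity of [kappa] thus makes the value at b
    positive, which excludes S empty, n = 0 and X b = 0. *)
Lemma main_term_le (b : 'cV[R]_p) : 0 < lam ->
  argmin (slice S w) (fun b => l2norm (X *m b) ^+ 2) b ->
  (0 < kappa X w S)%E ->
  X *m b != 0 /\ (main_term X w S lam <= (lam / l2norm (X *m b))%:E)%E.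
Proof.
move=> lam0 [bS bmin] kappa0.
have k0 : (0 < kappa2 X w S)%E.
  rewrite lt_def kappa2_ge0 andbT; apply: contraTneq kappa0 => k0.
  by rewrite /kappa k0 sqrte0 ltxx.
have kle : (kappa2 X w S <= (#|S|%:R * l2norm (X *m b) ^+ 2 / n%:R)%:E)%E.
  by apply: ereal_inf_lbound; exists b.
have := lt_le_trans k0 kle; rewrite lte_fin => k1.
have S0 : (0 < #|S|)%N.
  by rewrite lt0n; apply: contraTneq k1 => ->; rewrite !mul0r ltxx.
have n0 : (0 < n)%N.
  rewrite lt0n -(pnatr_eq0 R); apply: contraTneq k1 => ->.
  by rewrite invr0 mulr0 ltxx.
have Xb : X *m b != 0.
  by apply: contraTneq k1 => /eqP; rewrite -l2norm_eq0 => /eqP ->;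
    rewrite expr0n mulr0 mul0r ltxx.
split=> //; have E0 : 0 < l2norm (X *m b) by rewrite lt_def l2norm_ge0 l2norm_eq0 Xb.
rewrite -sqrt_ratio// lee_wpmul2r ?lee_fin//.
rewrite lee_sqrt ?mule_ge0 ?inve_ge0 ?lee_fin ?(ltW k1)//.
rewrite lee_wpmul2l ?lee_fin// lee_pV2 ?inE ?kappa2_ge0 ?lee_fin ?(ltW k1)//.
apply: le_ereal_inf_tmp => _ [c cS <-]; rewrite lee_fin ler_wpM2r ?invr_ge0//.
by rewrite ler_wpM2l//; exact: bmin.
Qed.

End main_term.

(** * The noise event and the bounds on it *)

Section noise_bounds.
Context d (T : measurableType d) (R : realType) (P : probability T R).
Context (n p : nat) (X : 'M[R]_(n, p)) (S : {set 'I_p}).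
Variable eps : 'I_n -> {RV P >-> R}.

Lemma noise_bounds (t x : R) :
  iid_std_gaussian eps -> gram X S \in unitmx -> 0 < t -> 0 < x ->
  prob_ge P
    [set o | let e := noise eps o in let U := lsmx X S *m e in
       [/\ forall j, j \notin S ->
             `|off_noise X S e j 0| <= v_off X S j 0 * noise_level p t,
           forall j (jS : j \in S), `|U j 0| <= uj X jS * noise_level p t &
           l2norm (X *m U) <= Num.sqrt #|S|%:R + Num.sqrt (2 * x)]]
    (1 - expR (- t) - expR (- x)).
Proof.
move=> gauss gramX t0 x0.
(* One vector per coordinate: the same p linear forms control U on S and V off S. *)
pose c j := if j \in S then (row j (lsmx X S))^T else residual X S j.
have [A [mA AE PA]] := gaussian_event gauss c (hatmx_sym X S) (hatmx_idem gramX)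
  (mxtrace_hatmx gramX) t0 x0.
exists A; split=> // o /AE[/= Hc HM]; split.
- move=> j jS; have := Hc j; rewrite /c (negbTE jS).
  by rewrite /off_noise /v_off !mxE !finset.in_setC jS.
- move=> j jS; have := Hc j; rewrite /c jS (l2norm_row_lsmx gramX).
  rewrite (_ : (lsmx X S *m noise eps o) j 0 = dot (row j (lsmx X S))^T (noise eps o))//.
  by rewrite dot_sum mxE; apply: eq_bigr => i _; rewrite !mxE.
- apply: l2norm_le_dot; first by rewrite addr_ge0.
  rewrite mulmxA -/(hatmx X S) -{1}(hatmx_sym X S) -dot_mulmx mulmxA.
  by rewrite hatmx_idem.
Qed.

End noise_bounds.

Section plug_in.
Context {R : realType} {n p : nat}.
Variables (X : 'M[R]_(n, p)) (beta0 : 'cV[R]_p) (e : 'cV[R]_n) (lam t x : R).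
Let S := supp beta0.
Let v := vbar X S lam t.
Let U := lsmx X S *m e.
Let V := off_noise X S e.
Hypothesis gramX : gram X S \in unitmx.
Hypothesis lam_gt : mx_norm (v_off X S) * noise_level p t < lam.
Hypothesis V_le : forall j, j \notin S ->
  `|V j 0| <= v_off X S j 0 * noise_level p t.
Hypothesis U_le : forall j (jS : j \in S), `|U j 0| <= uj X jS * noise_level p t.
Hypothesis XU_le : l2norm (X *m U) <= Num.sqrt #|S|%:R + Num.sqrt (2 * x).

Let lam0 : 0 < lam.
Proof.
apply: le_lt_trans lam_gt; rewrite mulr_ge0 ?sqrtr_ge0//.
exact: (normr_ge0 (v_off X S)).
Qed.

Let V_on j : j \in S -> V j 0 = 0.
Proof. by move=> jS; rewrite !mxE finset.in_setC jS. Qed.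

Let V_off j : j \notin S -> `|V j 0| <= lam * v j 0.
Proof. by move=> jS; rewrite [v j 0]mxE mulrC divfK ?gt_eqF// V_le. Qed.

Let U_off j : j \notin S -> U j 0 = 0.
Proof.
move=> jS; rewrite /U mxE big1// => i _.
by have /rowP/(_ i) := row_lsmx_off X jS; rewrite !mxE => ->; rewrite mul0r.
Qed.

Let v1 j : j \notin S -> v j 0 < 1.
Proof.
move=> jS; rewrite mxE ltr_pdivrMr// mul1r; apply: le_lt_trans lam_gt.
rewrite ler_wpM2r ?sqrtr_ge0// (le_trans (ler_norm _))//.
by move: j {jS}; apply/mx_norm_leP => //; exact: (normr_ge0 (v_off X S)).
Qed.

Let eUV := noise_decomp gramX e.

Lemma lasso_upper b : lasso X (X *m beta0 + e) lam b ->
  ((l2norm (X *m (b - beta0)))%:E <= main_term X (minus1 S v) S lam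
     + (Num.sqrt #|S|%:R)%:E + (Num.sqrt (2 * x))%:E)%E.
Proof.
move=> bL.
have := lasso_sqr_error lam0 eUV V_on V_off v1 bL.
set D := b - beta0; set E := l2norm (X *m D); set q := l1gap _ _ _ => EE.
rewrite -addeA -EFinD.
have E_ge0 : 0 <= E by exact: l2norm_ge0.
have [E0|E0] := eqVneq E 0.
  by rewrite E0 adde_ge0 ?main_term_ge0// lee_fin addr_ge0.
have Epos : 0 < E by rewrite lt_def E0.
(* If the gap is nonpositive, the quadratic inequality gives E <= |XU|; otherwise dividing it by E
   leaves the extra term lam q / E, which the main term dominates. *)
have [q0|q0] := leP q 0.
  rewrite -[leLHS]add0e; apply: leeD; first exact: main_term_ge0.
  rewrite lee_fin (le_trans _ XU_le)// -(ler_pM2r Epos) -expr2.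
  by rewrite (le_trans EE)// gerDl pmulr_rle0.
have XD0 : X *m D != 0 by rewrite -l2norm_eq0.
have n0 : (0 < n)%N.
  rewrite lt0n; apply: contra_neqN XD0 => /eqP n0; apply/matrixP => i.
  by exfalso; have := ltn_ord i; rewrite [X in (_ < X)%N]n0.
apply: le_trans (leeD (le_main_term n0 lam0 XD0 q0) (lexx _)).
rewrite -EFinD lee_fin -/E -/q.
have : E <= l2norm (X *m U) + lam * q / E.
  by rewrite -(ler_pM2r Epos) -expr2 mulrDl divfK.
have := XU_le; lra.
Qed.

Lemma lasso_lower bstar (b : 'cV[R]_p -> 'cV[R]_p) :
  let z := sign_on S bstar in
  bstar_set X S v bstar ->
  (forall w, weights S v w -> bw_set X S z w (b w)) ->
  (0 < kappa X (plus1 S v) S)%E ->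
  (forall (j : 'I_p) (jS : j \in S),
     (lam%:E * (bold_b X S v b j + (ubar X lam t jS)%:E) < `|beta0 j 0|%:E)%E
     /\ Num.sg (beta0 j 0) = z j 0) ->
  exists2 bhat, lasso_kkt X beta0 e lam bhat &
    (main_term X (plus1 S v) S lam
     - (Num.sqrt #|S|%:R)%:E - (Num.sqrt (2 * x))%:E
     <= (l2norm (X *m (bhat - beta0)))%:E)%E.
Proof.
move=> z bstarP bP kappa0 betamin.
have [bhat bL] := lasso_nonempty X (X *m beta0 + e) lam0.
have bkkt := lasso_sub_kkt lam0 bL.
exists bhat => //; have [zeta zb kkt] := bkkt.
set w := kkt_weights beta0 lam V v zeta.
have wW : weights S v w := kkt_weightsP lam0 V_off zb.
have bw := bP w wW.
have bold_ge j : ((`|b w j 0|%:E / (l2norm (X *m b w) ^+ 2)%:E) <= bold_b X S v b j)%E.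
  by apply: ereal_sup_ubound; exists w.
have [Xbs0 main_le] := main_term_le lam0 bstarP kappa0.
have Xbw0 : X *m b w != 0.
  (* Feasibility of b(w) gives a j in S with b_j(w) nonzero; if X b(w) = 0, then [bold_b] is +oo at
     j, contradicting betamin. *)
  apply/eqP => Xbw0.
  have [j jS bj] : exists2 j, j \in S & b w j 0 != 0.
    apply/exists_inP; apply: contraPT bw.1 => /exists_inPn H.
    rewrite /= -/(signed_gap S z w (b w)) /signed_gap dot_restr big1; last first.
      by move=> j /H; rewrite negbK => /eqP ->; rewrite mulr0.
    apply/negP; rewrite -ltNge sub0r (@le_lt_trans _ _ 0)// oppr_le0.
    by rewrite wl1_offE sumr_ge0.
  have := (betamin j jS).1; have := bold_ge j.
  rewrite Xbw0 (_ : l2norm 0 = 0); last by apply/eqP; rewrite l2norm_eq0.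
  rewrite expr0n inve0 gt0_muley ?lte_fin ?normr_gt0// leye_eq => /eqP ->.
  by rewrite addye// gt0_muley ?lte_fin//.
have C0 : 0 < l2norm (X *m b w) by rewrite lt_def l2norm_ge0 l2norm_eq0 Xbw0.
have zS j : j \in S -> z j 0 = Num.sg (beta0 j 0).
  by move=> jS; rewrite (betamin j jS).2.
have fit : l2norm (X *m (bhat - beta0 - U)) = lam / l2norm (X *m b w).
  apply: (kkt_fit lam0 eUV U_off V_on V_off v1 zb kkt bw Xbw0 zS).
  move=> j jS; have := (betamin j jS).1; have := bold_ge j.
  rewrite inver sqrf_eq0 gt_eqF// -EFinM => bb lt.
  have : (lam%:E * ((`|b w j 0| / l2norm (X *m b w) ^+ 2)%:E +
                    (ubar X lam t jS)%:E) <= `|beta0 j 0|%:E)%E.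
    apply: le_trans (ltW lt); rewrite lee_pmul2l ?lte_fin//.
    exact: leeD.
  rewrite -EFinD -EFinM lee_fin mulrDr mulrA addrC; apply: le_trans.
  by rewrite lerD2r /ubar mulrC divfK ?gt_eqF// U_le.
rewrite -addeA -oppeD// leeBlDr// -EFinD.
apply: (le_trans main_le); rewrite lee_fin.
(* [bstar] is feasible for the problem defining b(w): z carries its signs, so the linear form is its
   l1 norm on S, and w_j <= 1 + v_j. *)
have bstar_fit : l2norm (X *m b w) <= l2norm (X *m bstar).
  rewrite -ler_sqr ?nnegrE ?l2norm_ge0//; apply: bw.2 => /=.
  rewrite -/(signed_gap S z w bstar) -[leLHS]bstarP.1 l1norm_restr /signed_gap dot_restr.
  apply: lerB.
    by apply: ler_sum => j jS; rewrite !mxE jS -normrEsg.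
  rewrite !wl1_offE; apply: ler_sum => j jS; rewrite !normrM ler_wpM2r//.
  have := wW j; rewrite (negbTE jS) => /andP[w1 w2].
  rewrite plus1_off// !ger0_norm//; have := v1 jS; lra.
have : lam / l2norm (X *m bstar) <= lam / l2norm (X *m b w).
  by rewrite ler_pM2l// lef_pV2// posrE lt_def l2norm_ge0 l2norm_eq0 Xbs0.
have : l2norm (X *m (bhat - beta0 - U)) <= l2norm (X *m (bhat - beta0)) + l2norm (X *m U).
  by rewrite mulmxBr (le_trans (l2normD _ _))// l2normN.
rewrite fit; have := XU_le; lra.
Qed.

End plug_in.

Theorem corollary8p1 (R : realType) (d : measure_display)
    (Omega : measurableType d) (P : probability Omega R) (n p : nat)
    (X : 'M[R]_(n, p)) (beta0 : 'cV[R]_p) (eps : 'I_n -> {RV P >-> R})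
    (lam t : R) :
  let S0 := supp beta0 in
  let Y := fun o => X *m beta0 + noise eps o in
  let v := vbar X S0 lam t in
  let err := fun b => l2norm (X *m (b - beta0)) in
  let upper := fun x b =>
    ((err b)%:E <= main_term X (minus1 S0 v) S0 lam
                   + (Num.sqrt #|S0|%:R)%:E + (Num.sqrt (2 * x))%:E)%E in
  let lower := fun x b =>
    (main_term X (plus1 S0 v) S0 lam
     - (Num.sqrt #|S0|%:R)%:E - (Num.sqrt (2 * x))%:E <= (err b)%:E)%E in
  iid_std_gaussian eps ->
  gram X S0 \in unitmx ->
  0 < t ->
  mx_norm (v_off X S0) * noise_level p t < lam ->
  (forall x : R, 0 < x ->
     prob_ge P [set o | forall bhat, lasso X (Y o) lam bhat -> upper x bhat]
       (1 - expR (- t) - expR (- x)))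
  /\
  (forall (bstar : 'cV[R]_p) (b : 'cV[R]_p -> 'cV[R]_p),
     let z := sign_on S0 bstar in
     bstar_set X S0 v bstar ->
     (forall w, weights S0 v w -> bw_set X S0 z w (b w)) ->
     (0 < kappa X (plus1 S0 v) S0)%E ->
     (forall (j : 'I_p) (jS : j \in S0),
        (lam%:E * (bold_b X S0 v b j + (ubar X lam t jS)%:E)
           < `|beta0 j 0|%:E)%E
        /\ Num.sg (beta0 j 0) = z j 0) ->
     forall x : R, 0 < x ->
     prob_ge P
       [set o | (forall bhat, lasso X (Y o) lam bhat -> upper x bhat)
              /\ exists2 bhat, lasso_kkt X beta0 (noise eps o) lam bhat
                             & lower x bhat]
       (1 - expR (- t) - expR (- x))).
Proof.
move=> S0 Y v err upper lower gauss gramX t0 lam_gt.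
(* All the randomness is in [noise_bounds]: on its event both bounds hold pointwise, so having them
   simultaneously costs no further probability. *)
split=> [x x0|bstar b z bstarP bP kappa0 betamin x x0];
  have [A [mA AE PA]] := noise_bounds gauss gramX t0 x0;
  exists A; split=> // o /AE[/= V_le U_le XU_le].
  by move=> bhat bL; exact: lasso_upper bL.
split; first by move=> bhat bL; exact: lasso_upper bL.
exact: lasso_lower bP kappa0 betamin.
Qed.
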